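(* The following two statements are equivalent: (i) every locally compact $c$-compact (Hausdorff) topological group admitting small invariant neighborhoods is compact; (ii) every countable hereditarily non-topologizable group is finite.
   Context: All topological groups considered are Hausdorff. A Hausdorff topological group $G$ is $c$-compact if for every Hausdorff topological group $H$, the image of every closed subgroup of $G \times H$ under the projection $\pi_H\colon G \times H \rightarrow H$ is closed in $H$. A topological group $G$ has (admits) small invariant neighborhoods if every neighborhood $U$ of the identity $e \in G$ contains a neighborhood $V$ of $e$ such that $g^{-1}Vg = V$ for all $g \in G$. A group $G$ is non-topologizable if the only Hausdorff group topology that $G$ admits is the discrete one. A group $G$ is hereditarily non-topologizable if $H/N$ is non-topologizable for every subgroup $H \leq G$ and every normal subgroup $N$ of $H$. *)

(* Defs.v *)
From HB Require Import structures.
From mathcomp Require Import all_boot generic_quotient.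
From mathcomp Require Import all_classical.
From mathcomp Require Import topology.

Set Implicit Arguments.
Unset Strict Implicit.
Unset Printing Implicit Defensive.

Local Open Scope classical_set_scope.
Local Open Scope group_scope.

HB.structure Definition PreTopologicalGroup := {G of Topological G & Group G}.

HB.mixin Record PreTopologicalGroup_isTopologicalGroup G
    of PreTopologicalGroup G := {
  mulg_continuous : continuous (fun p : G * G => p.1 * p.2);
  invg_continuous : continuous (fun x : G => x^-1)
}.

#[short(type="topologicalGroupType")]
HB.structure Definition TopologicalGroup :=
  {G of PreTopologicalGroup G & PreTopologicalGroup_isTopologicalGroup G}.

(* Meant for Hausdorff G.  Predicates S : {pred _} are boolean; since [asbool]
   makes every Prop-valued predicate boolean, [groupClosed (G * H)] ranges over
   all subgroups of G * H. *)
Definition c_compact (G : topologicalGroupType) : Prop :=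
  forall H : topologicalGroupType, hausdorff_space H ->
  forall S : groupClosed (G * H)%type,
    closed [set p : G * H | p \in S] ->
    closed ((fun p : G * H => p.2) @` [set p : G * H | p \in S]).

(* [v ^ g] is the conjugate g^-1 * (v * g). *)
Definition small_invariant_nbhs (G : topologicalGroupType) : Prop :=
  forall U : set G, nbhs (1 : G) U ->
  exists V : set G, [/\ nbhs (1 : G) V, V `<=` U &
    forall g : G, [set v ^ g | v in V] = V].

Record topology_on (T : Type) := TopologyOn {
  is_open : set_system T;
  is_openT : is_open [set: T];
  is_openI : setI_closed is_open;
  is_open_bigU : forall (I : Type) (f : I -> set T),
    (forall i, is_open (f i)) -> is_open (\bigcup_i f i)
}.

(* The group G, seen as a topological space via tau. *)
Definition topologized (G : groupType) (tau : topology_on G) : Type := G.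

HB.instance Definition _ (G : groupType) (tau : topology_on G) :=
  Group.on (topologized tau).
HB.instance Definition _ (G : groupType) (tau : topology_on G) :=
  isOpenTopological.Build (topologized tau)
    (is_openT tau) (@is_openI _ tau) (@is_open_bigU _ tau).

Lemma open_topologizedE (G : groupType) (tau : topology_on G) :
  @open (topologized tau) = is_open tau.
Proof. by []. Qed.

Definition is_group_topology (G : groupType) (tau : topology_on G) : Prop :=
  continuous (fun p : topologized tau * topologized tau => p.1 * p.2) /\
  continuous (fun x : topologized tau => x^-1).

Definition non_topologizable (G : groupType) : Prop :=
  forall tau : topology_on G,
    is_group_topology tau -> hausdorff_space (topologized tau) ->
    forall A : set G, is_open tau A.

Definition subgroup_type (G : groupType) (H : groupClosed G) : Type :=
  {x : G | x \in H}.

Section SubgroupType.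
Variables (G : groupType) (H : groupClosed G).

Fact groupClosed_group_closed : group_closed (fun x : G => x \in H).
Proof. by split=> [|x y xH yH]; [exact: gpred1 | exact: gpredF]. Qed.

HB.instance Definition _ := SubChoice.on (subgroup_type H).
HB.instance Definition _ :=
  SubChoice_isSubGroup.Build G _ (subgroup_type H) groupClosed_group_closed.

End SubgroupType.

HB.mixin Record isConjgClosed (G : groupType) (N : {pred G}) := {
  gpredJ_normal : forall x g : G, x \in N -> x ^ g \in N
}.

#[short(type="normalClosed")]
HB.structure Definition NormalClosed (G : groupType) :=
  {N of GroupClosed G N & isConjgClosed G N}.

Section QuotientGroup.
Variables (G : groupType) (N : normalClosed G).
Implicit Types x y z : G.

Definition coset_rel x y : bool := x^-1 * y \in N.

Fact coset_rel_refl : reflexive coset_rel.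
Proof. by move=> x; rewrite /coset_rel mulVg gpred1. Qed.

Fact coset_rel_sym : symmetric coset_rel.
Proof. by move=> x y; rewrite /coset_rel -gpredV invgM invgK. Qed.

Fact coset_rel_trans : transitive coset_rel.
Proof.
move=> y x z xy yz; rewrite /coset_rel.
by rewrite -[x^-1](mulgK y) -mulgA gpredM.
Qed.

Canonical coset_equiv :=
  EquivRel coset_rel coset_rel_refl coset_rel_sym coset_rel_trans.

Definition quotient_group : Type := {eq_quot coset_equiv}%qT.

HB.instance Definition _ := Choice.on quotient_group.
HB.instance Definition _ : EqQuotient _ coset_equiv quotient_group :=
  EqQuotient.on quotient_group.

Local Notation pi := (\pi_quotient_group)%qT.

Definition quot_one : quotient_group := pi 1.
Definition quot_inv := lift_op1 quotient_group (fun x : G => x^-1).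
Definition quot_mul := lift_op2 quotient_group (fun x y : G => x * y).

Lemma eq_coset x y : pi x = pi y <-> x^-1 * y \in N.
Proof. by split=> [/eqmodP|xy]; last exact/eqmodP. Qed.

Lemma quot_invE x : quot_inv (pi x) = pi x^-1.
Proof.
rewrite /quot_inv -lock.
apply/eq_coset; rewrite invgK.
have /eq_coset xN : pi x = pi (repr (pi x)) by rewrite reprK.
set x' := repr (pi x) in xN *.
have -> : x' * x^-1 = (x^-1 * x') ^ x^-1.
  by rewrite conjgE invgK !mulgA mulgV mul1g.
exact: gpredJ_normal.
Qed.

Lemma quot_mulE x y : quot_mul (pi x) (pi y) = pi (x * y).
Proof.
rewrite /quot_mul -lock.
apply/esym/eq_coset.
have /eq_coset xN : pi x = pi (repr (pi x)) by rewrite reprK.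
have /eq_coset yN : pi y = pi (repr (pi y)) by rewrite reprK.
set x' := repr (pi x) in xN *; set y' := repr (pi y) in yN *.
have -> : (x * y)^-1 * (x' * y') = (x^-1 * x') ^ y * (y^-1 * y').
  by rewrite conjgE invgM -!mulgA mulVKg.
by rewrite gpredM // gpredJ_normal.
Qed.

Fact quot_mulA : associative quot_mul.
Proof.
elim/quotW=> x; elim/quotW=> y; elim/quotW=> z.
by rewrite !quot_mulE mulgA.
Qed.
Fact quot_mul1 : left_id quot_one quot_mul.
Proof. by elim/quotW=> x; rewrite quot_mulE mul1g. Qed.
Fact quot_mulr1 : right_id quot_one quot_mul.
Proof. by elim/quotW=> x; rewrite quot_mulE mulg1. Qed.
Fact quot_mulV : left_inverse quot_one quot_inv quot_mul.
Proof. by elim/quotW=> x; rewrite quot_invE quot_mulE mulVg. Qed.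
Fact quot_mulrV : right_inverse quot_one quot_inv quot_mul.
Proof. by elim/quotW=> x; rewrite quot_invE quot_mulE mulgV. Qed.

HB.instance Definition _ := isGroup.Build quotient_group
  quot_mulA quot_mul1 quot_mulr1 quot_mulV quot_mulrV.

End QuotientGroup.

Definition hereditarily_non_topologizable (G : groupType) : Prop :=
  forall (H : groupClosed G) (N : normalClosed (subgroup_type H)),
    non_topologizable (quotient_group N).

(* Main.v *)
From HB Require Import structures.
Require Import Defs.
From mathcomp Require Import all_boot generic_quotient.
From mathcomp Require Import all_classical.
From mathcomp Require Import topology.

(** Both implications compare closed subgroups of a product with group
topologies on subquotients.

Compactness implies finiteness. A hereditarily non-topologizable group [G] is
c-compact for every group topology. Indeed, let [S] be a closed subgroup of
[G * H], with projections [A] and [P] and kernels [L] (the [g] with [(g, 1)] in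
[S]) and [M] (the [h] with [(1, h)] in [S]). The groups [A / L] and [P / M] are
isomorphic, and [M] is closed, so that [P / M] is Hausdorff; as [A / L] is a
subquotient of [G], it must be discrete. Hence [M] is open in [P], and a subgroup
that is closed near [1] is closed
([closed_snd_of_hereditarily_non_topologizable]). In particular the discrete
group [G] is c-compact, and it is finite as soon as it is compact.

Finiteness implies compactness. The source of all closedness arguments is a form
of completeness ([c_compact_complete]): if [phi] maps a closed subgroup [A] of a
c-compact group continuously into a group [P] topologized by a decreasing
sequence of neighbourhoods, then two-sided Cauchy sequences in [phi @` A]
converge there. The pairs [(g, c)] such that the sequence [c] tends to [phi g]
form a closed subgroup, and every Cauchy sequence is a limit of convergent ones.
Baire's argument ([baire]) then has two applications.

- If [P] is countable and [phi] is locally constant and onto, each Hausdorff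
  group topology of [P] is finer than a metrizable one, which is complete, hence
  has an isolated point. So [P] is hereditarily non-topologizable, and finite by
  assumption. It follows that a subgroup of countable index which is open in a
  closed subgroup has finite index in it ([countable_index_finite]), that an open
  normal subgroup has finite index ([open_normal_index_finite]), and that no
  infinite cyclic subgroup is discrete, whence every monothetic subgroup is
  compact ([monothetic_compact]).

- Choose invariant neighbourhoods [U k] of [1], with [U k.+1] squared inside
  [U k] and [V = U 0] compact. Let [L] be the open normal subgroup generated by
  [V]. It acts on [V] by conjugation, equicontinuously, hence with totally bounded
  image for uniform convergence; this image is complete and is the union of the
  images of the compact sets [V ^ n]. By Baire's argument, [L = T Z] where [T] is
  compact and [Z] is the kernel of the action modulo the compact normal subgroup
  [K], the intersection of the [U k] ([generated_subgroup_cocompact]).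

The group [Z] is abelian modulo [K]. As [V] generates [L = T Z], only the compact
set [W] of the elements of [Z] of the form [t^-1 v t'] matters, and [W W] is
covered by finitely many [f W] with [f] in [Z]. The product [C] of [K] and of the
monothetic subgroups of these [f] is compact and absorbs the [f], whence
[L = T C W] is compact ([generated_subgroup_compact]). Finally [L] has finite
index, so [G] is compact. *)

Set Implicit Arguments.
Unset Strict Implicit.
Unset Printing Implicit Defensive.

Local Open Scope classical_set_scope.
Local Open Scope group_scope.

(** * Subgroups and group topologies *)

Definition subgroup_set (G : groupType) (A : set G) : Prop :=
  [/\ A 1, forall x y, A x -> A y -> A (x * y) & forall x, A x -> A x^-1].

(** The hypothesis is an argument of the predicate so that the closure properties
    can be inferred from the predicate alone. *)
Definition subgroup_pred (G : groupType) (A : set G)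
  (subA : subgroup_set A) : {pred G} := fun x => `[< A x >].

Section SubgroupPred.
Variables (G : groupType) (A : set G) (subA : subgroup_set A).

Lemma in_subgroup_pred x : (x \in subgroup_pred subA) = `[< A x >].
Proof. by []. Qed.

Fact subgroup_pred1 : 1 \in subgroup_pred subA.
Proof. by apply/asboolP; case: subA. Qed.

Fact subgroup_predM : {in subgroup_pred subA &, forall x y,
  x * y \in subgroup_pred subA}.
Proof.
by move=> x y /asboolP Ax /asboolP Ay; apply/asboolP; case: subA => _ AM _; apply: AM.
Qed.

Fact subgroup_predV : {in subgroup_pred subA, forall x,
  x^-1 \in subgroup_pred subA}.
Proof.
by move=> x /asboolP Ax; apply/asboolP; case: subA => _ _ AV; apply: AV.
Qed.

HB.instance Definition _ :=
  isMulClosed.Build G (subgroup_pred subA) subgroup_predM.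
HB.instance Definition _ :=
  isMul1Closed.Build G (subgroup_pred subA) subgroup_pred1.
HB.instance Definition _ :=
  isInvClosed.Build G (subgroup_pred subA) subgroup_predV.

End SubgroupPred.

Lemma subgroup_setP (G : groupType) (S : groupClosed G) :
  subgroup_set [set x | x \in S].
Proof.
split=> /= [|x y|x]; [exact: gpred1 | exact: gpredM | by rewrite gpredV].
Qed.

Lemma c_compact_closed_snd (G H : topologicalGroupType) (S : set (G * H)) :
  c_compact G -> hausdorff_space H -> subgroup_set S -> closed S ->
  closed [set h | exists g, S (g, h)].
Proof.
move=> cG hH subS clS.
have eS : [set p : G * H | p \in subgroup_pred subS] = S.
  by apply/funext => p /=; apply/propext; rewrite in_subgroup_pred asboolE.
have := cG H hH (subgroup_pred subS); rewrite eS => /(_ clS).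
congr closed; apply/funext => h; apply/propext; split.
  by case=> -[g h'] /= Sp <-; exists g.
by case=> g Sgh; exists (g, h).
Qed.

(** The axioms of the filter of neighbourhoods of [1] in a topological group;
    [filter_topology] is the converse construction. *)
Record group_filter (K : groupType) (F : set_system K) : Prop := GroupFilter {
  group_filter_filter : Filter F;
  group_filter1 : forall A, F A -> A 1;
  group_filterM : forall A, F A ->
    exists2 B, F B & forall x y, B x -> B y -> A (x * y);
  group_filterV : forall A, F A -> F [set x | A x^-1];
  group_filterJ : forall A g, F A -> F [set x | A (x ^ g)]
}.

Section FilterTopology.
Variables (K : groupType) (F : set_system K) (gF : group_filter F).

#[local] Instance group_filter_is_filter : Filter F := group_filter_filter gF.

Definition filter_open : set_system K :=
  [set A | forall x, A x -> F [set g | A (x * g)]].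

Fact filter_openT : filter_open setT.
Proof. by move=> x _; exact: filterT. Qed.

Fact filter_openI : setI_closed filter_open.
Proof. by move=> A B oA oB x [Ax Bx]; exact: filterI (oA x Ax) (oB x Bx). Qed.

Fact filter_open_bigU (I : Type) (f : I -> set K) :
  (forall i, filter_open (f i)) -> filter_open (\bigcup_i f i).
Proof.
move=> of_ x [i _ fix_]; apply: filterS (of_ i x fix_) => g /= fig.
by exists i.
Qed.

Definition filter_topology : topology_on K :=
  TopologyOn filter_openT filter_openI filter_open_bigU.

Lemma nbhs_filter_topology (x : topologized filter_topology) (A : set K) :
  nbhs x A <-> F [set g | A (x * g)].
Proof.
split=> [[B [oB Bx sBA]]|FA]; first by apply: filterS (oB x Bx) => g /= /sBA.
exists [set y | F [set g | A (y * g)]]; split => //.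
  move=> y /= /(group_filterM gF) [B FB BB].
  apply: filterS (FB) => h Bh /=.
  by apply: filterS (FB) => g Bg /=; rewrite -mulgA; apply: BB.
by move=> y /= /(group_filter1 gF) /=; rewrite mulg1.
Qed.

Lemma filter_topology_group : is_group_topology filter_topology.
Proof.
split=> [[x y]|x] A /nbhs_filter_topology.
  move=> /(group_filterM gF) [B FB BB].
  exists ([set z | B ((x^-1 * z) ^ y)], [set z | B (y^-1 * z)]).
    split; apply/nbhs_filter_topology => /=.
      rewrite [X in F X](_ : _ = [set g | B (g ^ y)]); last first.
        by apply/funext => g /=; rewrite mulKg.
      exact: (group_filterJ gF).
    rewrite [X in F X](_ : _ = B) //.
    by apply/funext => g /=; rewrite mulKg.
  move=> [u v] /= [Bu Bv]; have := BB _ _ Bu Bv => /=.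
  by rewrite conjgE -!mulgA !mulVKg.
move=> /(group_filterJ gF x^-1) /(group_filterV gF) FA.
apply/nbhs_filter_topology; apply: filterS FA => g /=.
congr A; rewrite conjgE invgK invgM.
by rewrite !mulgA !mulVg ?mul1g.
Qed.

End FilterTopology.

Definition topological_group (K : groupType) (tau : topology_on K)
    (tauP : is_group_topology tau) : topologicalGroupType :=
  HB.pack (topologized tau)
    (PreTopologicalGroup_isTopologicalGroup.Build (topologized tau)
       tauP.1 tauP.2).

(** * Closed subgroups and compact subsets of topological groups *)

Section TopologicalGroupTheory.
Variable G : topologicalGroupType.
Implicit Types (x y g : G) (A B U V : set G).

Lemma mulgl_continuous x : continuous (fun y : G => x * y).
Proof.
move=> y A /(@mulg_continuous G (x, y)) [[P Q] /= [Px Qy] sPQ].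
by apply: filterS Qy => z Qz; apply: (sPQ (x, z)); split=> //; exact: nbhs_singleton.
Qed.

Lemma mulgr_continuous y : continuous (fun x : G => x * y).
Proof.
move=> x A /(@mulg_continuous G (x, y)) [[P Q] /= [Px Qy] sPQ].
by apply: filterS Px => z Pz; apply: (sPQ (z, y)); split=> //; exact: nbhs_singleton.
Qed.

Lemma nbhs_mulg x A : nbhs x A <-> nbhs (1 : G) [set g | A (x * g)].
Proof.
split=> [xA|A1]; first by apply: mulgl_continuous; rewrite mulg1.
have /= := @mulgl_continuous x^-1 x _.
rewrite mulVg => /(_ _ A1) /=; rewrite /nbhs /=.
by apply: filterS => g /=; rewrite mulVKg.
Qed.

Lemma nbhs1_group_filter : group_filter (nbhs (1 : G)).
Proof.
split=> [|A|A|A|A g] /=; first exact: nbhs_filter.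
- exact: nbhs_singleton.
- rewrite -[X in nbhs X A](mulg1 1).
  move=> /(@mulg_continuous G (1, 1)) [[P Q] /= [P1 Q1] sPQ].
  exists (P `&` Q); first exact: filterI.
  by move=> x y [Px _] [_ Qy]; apply: (sPQ (x, y)).
- by rewrite -[X in nbhs X A]invg1 => /(@invg_continuous G 1).
- move=> A1; have : nbhs (g^-1 * (1 * g)) A by rewrite mul1g mulVg.
  by move=> /(@mulgl_continuous g^-1 (1 * g)) /(@mulgr_continuous g 1).
Qed.

Lemma nbhs1_div U : nbhs (1 : G) U ->
  exists2 V, nbhs (1 : G) V &
    forall x y, V x -> V y -> U (x^-1 * y) /\ U (x * y^-1).
Proof.
move=> /(group_filterM nbhs1_group_filter) [V V1 VV].
exists (V `&` [set x | V x^-1]).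
  by apply: filterI => //; exact: (group_filterV nbhs1_group_filter).
by move=> x y [Vx Vx'] [Vy Vy']; split; apply: VV.
Qed.

Lemma closure_mulg A x U : closure A x -> nbhs (1 : G) U ->
  exists2 a, A a & U (x^-1 * a).
Proof.
move=> clA U1; have : nbhs x [set y | U (x^-1 * y)].
  by apply/nbhs_mulg; apply: filterS U1 => g /=; rewrite mulKg.
by move=> /clA [a [Aa Ua]]; exists a.
Qed.

(** If [p] and [q] cannot be separated, then [p^-1 * q] is in every
    neighbourhood of [1]. *)
Lemma hausdorff_group :
  (forall x, x != 1 -> exists2 A, nbhs (1 : G) A & ~ A x) -> hausdorff_space G.
Proof.
move=> sep p q pq; apply/eqP; apply: contrapT => /negP npq.
have [] := sep (p^-1 * q).
  by apply: contra_neq npq => /mulg1_eq; rewrite invgK.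
move=> A /nbhs1_div [V V1 VV] [].
have pV : nbhs p [set y | V (p^-1 * y)].
  by apply/nbhs_mulg; apply: filterS V1 => g /=; rewrite mulKg.
have qV : nbhs q [set y | V (q^-1 * y)].
  by apply/nbhs_mulg; apply: filterS V1 => g /=; rewrite mulKg.
have [y /= [Vpy Vqy]] := pq _ _ pV qV.
by have [_] := VV _ _ Vpy Vqy; rewrite invgM invgK mulgA mulgK.
Qed.

Lemma hausdorff_sep x : hausdorff_space G -> x != 1 ->
  exists2 A, nbhs (1 : G) A & ~ A x.
Proof.
move=> hG xn1; exists [set~ x]; last by move=> /(_ erefl).
apply: open_nbhs_nbhs; split; last by move=> /= /esym /eqP; exact/negP.
apply: closed_openC; apply: accessible_closed_set1.
exact: hausdorff_accessible.
Qed.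

(** The complement of an open subgroup is a union of cosets. *)
Lemma open_subgroup_closed A : subgroup_set A -> nbhs (1 : G) A -> closed A.
Proof.
move=> [_ AM AV] A1 p /closure_mulg /(_ A1) [a Aa Apa].
by rewrite -[p]invgK -[p^-1](mulgK a); apply: (AV); apply: AM => //; exact: AV.
Qed.

(** Near [1] the subgroup [A] coincides with the closed subset [L], so a limit
    of [A] is a translate by [A] of a limit of [L]. *)
Lemma locally_closed_subgroup_closed A (L U : set G) : subgroup_set A ->
  L `<=` A -> closed L -> nbhs (1 : G) U -> A `&` U `<=` L -> closed A.
Proof.
move=> [_ AM AV] LA clL U1 AUL p clp.
have [V V1 VV] := nbhs1_div U1.
have [a Aa Va] := closure_mulg clp V1.
rewrite -[p](mulVKg a); apply: (AM) => //; apply: LA; apply: clL => B nB.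
have nB' : nbhs p [set y | V (p^-1 * y) /\ B (a^-1 * y)].
  apply: filterI; last exact: mulgl_continuous.
  by apply/nbhs_mulg; apply: filterS V1 => g /=; rewrite mulKg.
have [c [Ac [Vc Bc]]] := clp _ nB'.
exists (a^-1 * c); split => //; apply: AUL; split; first by apply: AM => //; exact: AV.
by have [+ _] := VV _ _ Va Vc; rewrite invgM invgK -mulgA mulVKg.
Qed.

Definition mulset A B : set G := [set a * b | a in A & b in B].

Lemma mulset_compact A B : compact A -> compact B -> compact (mulset A B).
Proof.
move=> cA cB; rewrite /mulset image2E.
apply: continuous_compact; last exact: compact_setX.
rewrite (_ : uncurry _ = fun p : G * G => p.1 * p.2); last by apply/funext => -[].
by apply: continuous_subspaceT => p; exact: mulg_continuous.
Qed.

Lemma mulsetM A B x y : A x -> B y -> mulset A B (x * y).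
Proof. by move=> Ax By; exists x => //; exists y. Qed.

End TopologicalGroupTheory.

Section Compactness.
Variable T : topologicalType.

Lemma compact_finite_cover (K : set T) (W : T -> set T) :
  compact K -> (forall x, K x -> nbhs x (W x)) ->
  exists2 s : seq T, (forall x, x \in s -> K x) &
    forall y, K y -> exists2 x, x \in s & W x y.
Proof.
move=> /compact_near_coveringP cK KW.
pose F : set_system (seq T) := [set A | exists2 s0 : seq T,
  (forall x, x \in s0 -> K x) & forall s, {subset s0 <= s} ->
  (forall x, x \in s -> K x) -> A s].
have FF : Filter F.
  split; first by exists [::].
    move=> A B [s sK sA] [t tK tB]; exists (s ++ t).
      by move=> x; rewrite mem_cat => /orP[/sK|/tK].
    move=> u stu uK; split; first by apply: sA => // x xs; apply: stu; rewrite mem_cat xs.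
    by apply: tB => // x xs; apply: stu; rewrite mem_cat xs orbT.
  by move=> A B AB [s sK sA]; exists s => // t st tK; apply: AB; exact: sA.
have [|s sK sP] := cK _ F (fun s y => exists2 x, x \in s & W x y) FF.
  move=> x Kx; exists (W x, [set s : seq T | x \in s]) => /=.
    split; first exact: KW.
    exists [:: x]; first by move=> y; rewrite inE => /eqP ->.
    by move=> s /(_ x) + _; apply; rewrite inE.
  by move=> [y s] [/= Wy xs]; exists x.
exists s => // y Ky.
by apply: (sP s).
Qed.

Lemma compact_nested (K : set T) (C : nat -> set T) :
  compact K -> (forall j, closed (C j)) -> (forall j, C j.+1 `<=` C j) ->
  (forall j, K `&` C j !=set0) -> exists2 x, K x & forall j, C j x.
Proof.
move=> cK clC Cdec KC.
have Cmono i j : (i <= j)%N -> C j `<=` C i.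
  by move=> /subnK <-; elim: (j - i)%N => // k IH x /Cdec /IH.
pose F : set_system T := [set A | exists j, K `&` C j `<=` A].
have FF : ProperFilter F.
  apply: Build_ProperFilter_ex.
    by move=> A [j sA]; have [x /sA] := KC j; exists x.
  split; first by exists 0%N.
    move=> A B [i sA] [j sB]; exists (maxn i j) => x [Kx Cx]; split.
      by apply: sA; split=> //; apply: Cmono Cx; exact: leq_maxl.
    by apply: sB; split=> //; apply: Cmono Cx; exact: leq_maxr.
  by move=> A B AB [j sA]; exists j => x /sA /AB.
have [|x [Kx Fx]] := cK F FF; first by exists 0%N => x [].
exists x => // j; apply: clC => B nB.
have [|y [Cy By]] := Fx (C j) B _ nB; first by exists j => y [].
by exists y.
Qed.

End Compactness.

Section FilterGroup.
Variables (K : groupType) (F : set_system K) (gF : group_filter F).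

Definition filter_group : topologicalGroupType :=
  topological_group (filter_topology_group gF).

Lemma nbhs_filter_group (x : filter_group) (A : set K) :
  nbhs x A <-> F [set g | A (x * g)].
Proof. exact: (@nbhs_filter_topology _ _ gF x A). Qed.

Lemma filter_group_hausdorff :
  (forall x, x != 1 -> exists2 B, F B & ~ B x) -> hausdorff_space filter_group.
Proof.
move=> sep; apply: hausdorff_group => x /sep [B FB nB]; exists B => //.
apply/nbhs_filter_group; rewrite [X in F X](_ : _ = B) //.
by apply/funext => g /=; rewrite mul1g.
Qed.

End FilterGroup.

(** * Subquotients *)

Section NormalPred.
Variables (K : groupType) (B : set K) (subB : subgroup_set B).
Hypothesis nB : forall x g, B x -> B (x ^ g).

(** The vacuous [let] records the normality of [B], from which the structure of
    normal subgroup is inferred. *)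
Definition normal_pred : {pred K} := let _ := nB in subgroup_pred subB.

Fact normal_predJ x g : x \in normal_pred -> x ^ g \in normal_pred.
Proof. by move=> /asboolP Bx; apply/asboolP/nB. Qed.

HB.instance Definition _ := GroupClosed.copy normal_pred (subgroup_pred subB).
HB.instance Definition _ := isConjgClosed.Build K normal_pred normal_predJ.

End NormalPred.

Section Subquotient.
Variables (G : groupType) (A L : set G).
Hypotheses (subA : subgroup_set A) (subL : subgroup_set L).
Hypothesis nL : forall x g, A g -> L x -> L (x ^ g).

Let A_type := subgroup_type (subgroup_pred subA).

Fact subquotient_ker_subgroup : subgroup_set [set u : A_type | L (val u)].
Proof. by case: subL => L1 LM LV; split=> /= [|u v|u]; [|exact: LM|exact: LV]. Qed.

Fact subquotient_ker_normal (u v : A_type) : L (val u) -> L (val (u ^ v)).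
Proof. by move=> Lu; apply: (nL _ Lu); apply/asboolP; exact: (valP v). Qed.

Definition subquotient : groupType :=
  quotient_group
    (normal_pred subquotient_ker_subgroup subquotient_ker_normal).

Definition to_subquotient (x : G) : subquotient :=
  if insub x is Some u then \pi_subquotient%qT (u : A_type) else 1.

Lemma to_subquotientE (u : A_type) :
  to_subquotient (val u) = \pi_subquotient%qT u.
Proof. by rewrite /to_subquotient valK. Qed.

Lemma subquotient_lift x : A x -> exists u : A_type, val u = x.
Proof. by move=> /asboolP Ax; exists (Sub x Ax); rewrite SubK. Qed.

Lemma to_subquotientM x y : A x -> A y ->
  to_subquotient (x * y) = to_subquotient x * to_subquotient y.
Proof.
move=> /subquotient_lift[u <-] /subquotient_lift[v <-].
by rewrite -valM !to_subquotientE; exact/esym/quot_mulE.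
Qed.

Lemma to_subquotient_eq x y : A x -> A y ->
  to_subquotient x = to_subquotient y <-> L (x^-1 * y).
Proof.
move=> /subquotient_lift[u <-] /subquotient_lift[v <-].
rewrite !to_subquotientE; apply: (iff_trans (eq_coset _ _ _)).
by split=> [/asboolP|Luv] //; apply/asboolP.
Qed.

Lemma to_subquotient_surj q : exists2 x, A x & to_subquotient x = q.
Proof.
elim/quotW: q => u; exists (val u); last exact: to_subquotientE.
by apply/asboolP; exact: (valP u).
Qed.

End Subquotient.

(** Maps which are multiplicative on a subgroup only. *)
Section MorphOn.
Variables (G P : groupType) (A : set G) (phi : G -> P).
Hypothesis subA : subgroup_set A.
Hypothesis phiM : forall x y, A x -> A y -> phi (x * y) = phi x * phi y.

Lemma morph_on1 : phi 1 = 1.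
Proof.
by case: subA => A1 _ _; apply: (mulgI (phi 1)); rewrite mulg1 -phiM ?mulg1.
Qed.

Lemma morph_onV x : A x -> phi x^-1 = (phi x)^-1.
Proof.
case: subA => _ _ AV Ax; apply: (mulgI (phi x)).
by rewrite -phiM ?mulgV ?morph_on1 //; exact: AV.
Qed.

Lemma morph_onJ x y : A x -> A y -> phi (x ^ y) = phi x ^ phi y.
Proof.
case: (subA) => _ AM AV Ax Ay; have AVy := AV _ Ay.
by rewrite !conjgE phiM ?phiM ?morph_onV //; exact: AM.
Qed.

End MorphOn.

(** * Hereditarily non-topologizable groups are c-compact *)

Section HereditarilyNonTopologizableCCompact.
Variables (G H : topologicalGroupType) (S : set (G * H)).
Hypotheses (subS : subgroup_set S) (clS : closed S).

Let A : set G := [set g | exists h, S (g, h)].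
Let L : set G := [set g | S (g, 1)].
Let M : set H := [set h | S (1, h)].

Let S1 : S (1, 1). Proof. by case: subS. Qed.
Let SM g h g' h' : S (g, h) -> S (g', h') -> S (g * g', h * h').
Proof. by move=> Sp Sq; case: subS => _ SM _; exact: (SM _ _ Sp Sq). Qed.
Let SV g h : S (g, h) -> S (g^-1, h^-1).
Proof. by move=> Sp; case: subS => _ _ SV; exact: (SV _ Sp). Qed.

Let subA : subgroup_set A.
Proof.
split=> [|x y [h Sx] [k Sy]|x [h Sx]]; first by exists 1.
- by exists (h * k); exact: SM.
- by exists h^-1; exact: SV.
Qed.

Let subL : subgroup_set L.
Proof.
split=> [//|x y Sx Sy|x Sx]; rewrite /L /=.
- by rewrite -[1]mulg1; exact: SM.
- by rewrite -[1]invg1; exact: SV.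
Qed.

Let nL x g : A g -> L x -> L (x ^ g).
Proof.
move=> [h Sg] Sx; rewrite /L /= -(mulVg h) -[X in h^-1 * X]mul1g.
by apply: SM; [exact: SV|exact: SM].
Qed.

Let Q := subquotient subA subL nL.
Let phi : G -> Q := to_subquotient subA subL nL.
Let phiM := @to_subquotientM _ _ _ subA subL nL : forall x y, A x -> A y ->
  phi (x * y) = phi x * phi y.
Let SA g h : S (g, h) -> A g. Proof. by exists h. Qed.

(** The topology of the second projection modulo [M], carried over to [Q] along
    the isomorphism between the quotients of the two projections. *)
Definition graph_filter : set_system Q :=
  [set B | exists2 U, nbhs (1 : H) U &
    forall g h, S (g, h) -> U h -> B (phi g)].

Lemma graph_group_filter : group_filter graph_filter.
Proof.
have gH := nbhs1_group_filter H.
split=> [|B|B|B|B q].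
- split; first by exists setT => //; exact: filterT.
    move=> B C [U U1 UB] [V V1 VC]; exists (U `&` V); first exact: filterI.
    by move=> g h Sgh [Uh Vh]; split; [exact: UB Uh|exact: VC Vh].
  by move=> B C BC [U U1 UB]; exists U => // g h Sgh Uh; apply/BC/(UB g h).
- move=> [U U1 UB]; rewrite -(morph_on1 subA phiM); apply: (UB 1 1) => //.
  exact: nbhs_singleton.
- move=> [U /(group_filterM gH) [V V1 VU] UB].
  exists [set q | exists g h, [/\ S (g, h), V h & phi g = q]].
    by exists V => // g h Sgh Vh; exists g, h.
  move=> _ _ [g [h [Sgh Vh <-]]] [g' [h' [Sgh' Vh' <-]]].
  rewrite -phiM; [|exact: SA Sgh|exact: SA Sgh'].
  by apply: (UB _ (h * h')); [exact: SM|exact: VU].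
- move=> [U /(group_filterV gH) U1 UB]; exists [set h | U h^-1] => // g h Sgh Uh /=.
  rewrite -(morph_onV subA phiM); last exact: SA Sgh.
  by apply: (UB _ h^-1) => //; exact: SV.
- move=> [U U1 UB]; have [a [b Sab] <-] := to_subquotient_surj q.
  exists [set h | U (h ^ b)]; first exact: (group_filterJ gH).
  move=> g h Sgh Uh /=; rewrite -(morph_onJ subA phiM).
  - by apply: (UB _ (h ^ b)) => //; rewrite !conjgE; do 2?apply: SM => //; exact: SV.
  - exact: SA Sgh.
  - exact: SA Sab.
Qed.

Lemma closed_snd_kernel : closed M.
Proof.
move=> h clh; apply: clS => C [[B D] /= [B1 Dh] sC].
have [k [Mk Dk]] := clh _ Dh.
by exists (1, k); split => //; apply: sC; split => //=; exact: nbhs_singleton.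
Qed.

(** The quotients of the projections of [S] by the kernels [L] and [M] are
    isomorphic; the first carries only discrete Hausdorff group topologies, so
    [M] is open in the second projection. *)
Lemma closed_snd_of_hereditarily_non_topologizable :
  hereditarily_non_topologizable G -> closed [set h | exists g, S (g, h)].
Proof.
move=> hG; have gF := graph_group_filter.
pose tau := filter_topology gF.
have tauG : is_group_topology tau := filter_topology_group gF.
have hQ : hausdorff_space (filter_group gF).
  apply: filter_group_hausdorff => q; have [g Ag <-] := to_subquotient_surj q => gn1.
  have [h Sgh] := Ag.
  (* [h M] is closed and avoids [1]: its complement separates [phi g] from 1. *)
  have nMh : ~ M h^-1.
    move=> Mh; apply: (negP gn1); apply/eqP; rewrite -(morph_on1 subA phiM).
    apply/esym/to_subquotient_eq => //; first by case: subA.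
    by rewrite /L /= invg1 -(mulVg h); exact: SM Mh Sgh.
  have nU : nbhs (1 : H) [set k | ~ M (h^-1 * k)].
    apply/(nbhs_mulg h^-1 (~` M)); apply: open_nbhs_nbhs; split => //.
    exact/closed_openC/closed_snd_kernel.
  exists [set p | exists g' h', [/\ S (g', h'), ~ M (h^-1 * h') & phi g' = p]].
    by exists [set k | ~ M (h^-1 * k)] => // g' h' Sgh' Mh'; exists g', h'.
  move=> [g' [h' [Sgh' Mh' /(to_subquotient_eq _ _ _ (SA Sgh') Ag) Lg]]].
  apply: Mh'; rewrite /M /=.
  have -> : 1 = g^-1 * (g' * (g'^-1 * g)) by rewrite mulVKg mulVg.
  have -> : h^-1 * h' = h^-1 * (h' * 1) by rewrite mulg1.
  by apply: SM; [exact: SV|exact: SM].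
have [U U1 UP] : graph_filter [set q | q = 1].
  have := hG _ _ tau tauG hQ [set 1] 1 erefl.
  by congr graph_filter; apply/funext => q /=; rewrite mul1g.
apply: (@locally_closed_subgroup_closed _ _ M U) => //.
- split=> [|x y [h Sx] [k Sy]|x [h Sx]]; first by exists 1.
  + by exists (h * k); exact: SM.
  + by exists h^-1; exact: SV.
- by move=> h Mh; exists 1.
- exact: closed_snd_kernel.
- move=> h [[g Sgh] Uh]; have := UP _ _ Sgh Uh => /=.
  rewrite -(morph_on1 subA phiM) => /(to_subquotient_eq _ _ _ (SA Sgh) (SA S1)).
  rewrite mulg1 => Lg; rewrite /M /= -(mulVg g) -[h]mul1g.
  by have := SM Lg Sgh; rewrite mulVg.
Qed.

End HereditarilyNonTopologizableCCompact.

(** The topology of [G] is arbitrary: only the abstract subquotients of [G] enter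
    the argument. *)
Lemma hereditarily_non_topologizable_c_compact (G : topologicalGroupType) :
  hereditarily_non_topologizable G -> c_compact G.
Proof.
move=> hG H hH S clS.
have := closed_snd_of_hereditarily_non_topologizable (subgroup_setP S) clS hG.
congr closed; apply/funext => h; apply/propext; split.
  by case=> g Sgh; exists (g, h).
by case=> -[g h'] /= Sp <-; exists g.
Qed.

Section DiscreteGroup.
Variable G : groupType.

Lemma principal_group_filter : group_filter [set A : set G | A 1].
Proof.
split=> [|//|A A1|A|A g] /=; last by rewrite conj1g.
- by split=> [//|A B A1 B1|A B AB A1]; [split|exact: AB].
- by exists [set 1] => // x y -> ->; rewrite mulg1.
- by rewrite invg1.
Qed.

Definition discrete_group : topologicalGroupType :=
  filter_group principal_group_filter.

Lemma nbhs_discrete_group (x : discrete_group) (A : set G) : nbhs x A <-> A x.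
Proof.
by have := @nbhs_filter_group _ _ principal_group_filter x A; rewrite /= mulg1.
Qed.

Lemma discrete_group_hausdorff : hausdorff_space discrete_group.
Proof.
apply: filter_group_hausdorff => x xn1; exists [set 1] => //= x1.
by rewrite x1 eqxx in xn1.
Qed.

Lemma discrete_group_locally_compact : locally_compact [set: discrete_group].
Proof.
move=> x _; exists [set x]; first exact/(nbhs_discrete_group x).
split; first exact: compact_set1.
by apply: compact_closed; [exact: discrete_group_hausdorff|exact: compact_set1].
Qed.

Lemma discrete_group_small_invariant_nbhs : small_invariant_nbhs discrete_group.
Proof.
move=> U /nbhs_singleton U1; exists [set 1]; split.
- exact/(nbhs_discrete_group 1).
- by move=> _ ->.
- move=> g; apply/funext => x; apply/propext; split=> [[_ -> <-]|->].
    exact: conj1g.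
  by exists 1 => //; exact: conj1g.
Qed.

Lemma discrete_group_compact_finite :
  compact [set: discrete_group] -> finite_set [set: G].
Proof.
move=> /(@compact_finite_cover _ _ set1) [|s _ sT].
  by move=> x _; exact/(nbhs_discrete_group x).
by apply/finite_seqP; exists s; apply/funext => x; apply/propext; split=> // _;
  have [y ys ->] := sT x I.
Qed.

End DiscreteGroup.

Lemma discrete_groupE (G : groupType) : (discrete_group G : groupType) = G.
Proof.
(* The two structures have the same components, but the equality is a conversion
   only once [G] is in constructor form. *)
by case: G => T [*].
Qed.

Lemma finite_of_compact_discrete :
  (forall G : topologicalGroupType, hausdorff_space G ->
     locally_compact [set: G] -> c_compact G -> small_invariant_nbhs G ->
     compact [set: G]) ->
  forall G : groupType, hereditarily_non_topologizable G ->
    finite_set [set: G].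
Proof.
move=> cpt G hG; apply: discrete_group_compact_finite; apply: cpt.
- exact: discrete_group_hausdorff.
- exact: discrete_group_locally_compact.
- apply: hereditarily_non_topologizable_c_compact.
  by rewrite discrete_groupE.
- exact: discrete_group_small_invariant_nbhs.
Qed.

Lemma mulg_insert (G : groupType) (z x y : G) : x * y = (x * z) * (z^-1 * y).
Proof. by rewrite -mulgA mulVKg. Qed.

(** * Sequential completeness of images of c-compact groups *)

(** A countable base of neighbourhoods of [1] for a group topology, which need
    not be Hausdorff. *)
Record nbhs_chain (P : groupType) (N : nat -> set P) : Prop := NbhsChain {
  nbhs_chain1 : forall k, N k 1;
  nbhs_chainV : forall k x, N k x -> N k x^-1;
  nbhs_chainM : forall k x y, N k.+1 x -> N k.+1 y -> N k (x * y);
  nbhs_chainJ : forall k g, exists j, forall x, N j x -> N k (x ^ g)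
}.

Section NbhsChain.
Variables (P : groupType) (N : nat -> set P) (cN : nbhs_chain N).

Let N1 := nbhs_chain1 cN.
Let NV := nbhs_chainV cN.
Let NM := nbhs_chainM cN.
Let NJ := nbhs_chainJ cN.

Lemma nbhs_chainS k : N k.+1 `<=` N k.
Proof. by move=> x Nx; rewrite -[x]mulg1; exact: NM. Qed.

Lemma nbhs_chain_mono i j : (i <= j)%N -> N j `<=` N i.
Proof.
by move=> /subnK <-; elim: (j - i)%N => // k IH x /nbhs_chainS /IH.
Qed.

Lemma nbhs_chainM3 k x y z : N k.+2 x -> N k.+2 y -> N k.+2 z ->
  N k (x * y * z).
Proof. by move=> Nx Ny Nz; apply: NM; [exact: NM|exact: nbhs_chainS]. Qed.

Definition chain_converges (x : nat -> P) (l : P) : Prop :=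
  forall k, exists m, forall n, (m <= n)%N -> N k ((x n)^-1 * l).

(** Cauchy on both sides: [cauchy_equinormal] needs the inverse sequence to be
    Cauchy as well. *)
Definition chain_cauchy (x : nat -> P) : Prop :=
  forall k, exists m, forall i j, (m <= i)%N -> (m <= j)%N ->
    N k ((x i)^-1 * x j) /\ N k (x i * (x j)^-1).

(** Conjugation by the tail of [c] and by its inverse is equicontinuous at [1].
    The sequences with this property are those for which [sequence_ball] is a
    base of neighbourhoods of [1] in a group topology. *)
Definition equinormal (c : nat -> P) : Prop :=
  forall k, exists j m, forall n x, (m <= n)%N -> N j x ->
    N k (x ^ c n) /\ N k (x ^ (c n)^-1).

(** The tail of [c] lies in a coset [d m * N _], and conjugation by [d m] is
    continuous. *)
Lemma cauchy_equinormal c : chain_cauchy c -> equinormal c.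
Proof.
move=> cc.
have half d : chain_cauchy d -> forall k, exists j m, forall n x, (m <= n)%N ->
    N j x -> N k (x ^ d n).
  move=> cd k; have [m dm] := cd k.+2; have [j dj] := NJ k.+2 (d m).
  exists j, m => n x mn Nx.
  have [Nu _] := dm _ _ (leqnn m) mn.
  have -> : x ^ d n = ((d m)^-1 * d n)^-1 * x ^ d m * ((d m)^-1 * d n).
    by rewrite !conjgE invgM invgK -!mulgA !mulVKg.
  by apply: nbhs_chainM3 => //; [exact: NV | exact: dj].
have ccV : chain_cauchy (fun n => (c n)^-1).
  move=> k; have [m cm] := cc k; exists m => i j mi mj; rewrite !invgK.
  by have [] := cm _ _ mi mj.
move=> k; have [j1 [m1 H1]] := half _ cc k; have [j2 [m2 H2]] := half _ ccV k.
exists (maxn j1 j2), (maxn m1 m2) => n x; rewrite geq_max => /andP[mn1 mn2] Nx.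
split; [apply: H1|apply: H2] => //.
  by apply: nbhs_chain_mono Nx; exact: leq_maxl.
by apply: nbhs_chain_mono Nx; exact: leq_maxr.
Qed.

(** A name for the type of sequences that carries the pointwise group law. *)
Definition sequence_group := nat -> P.

HB.instance Definition _ := Choice.on sequence_group.

Section SequenceGroup.
Implicit Types c d : sequence_group.
Fact sequence_mulA :
  associative (fun c d : sequence_group => (fun n => c n * d n) : sequence_group).
Proof. by move=> c d e; apply/funext => n; rewrite mulgA. Qed.
Fact sequence_mul1 :
  left_id ((fun=> 1) : sequence_group)
    (fun c d : sequence_group => (fun n => c n * d n) : sequence_group).
Proof. by move=> c; apply/funext => n; rewrite mul1g. Qed.
Fact sequence_mulr1 :
  right_id ((fun=> 1) : sequence_group)
    (fun c d : sequence_group => (fun n => c n * d n) : sequence_group).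
Proof. by move=> c; apply/funext => n; rewrite mulg1. Qed.
Fact sequence_mulV :
  left_inverse ((fun=> 1) : sequence_group)
    (fun c : sequence_group => (fun n => (c n)^-1) : sequence_group)
    (fun c d : sequence_group => (fun n => c n * d n) : sequence_group).
Proof. by move=> c; apply/funext => n; rewrite mulVg. Qed.
Fact sequence_mulrV :
  right_inverse ((fun=> 1) : sequence_group)
    (fun c : sequence_group => (fun n => (c n)^-1) : sequence_group)
    (fun c d : sequence_group => (fun n => c n * d n) : sequence_group).
Proof. by move=> c; apply/funext => n; rewrite mulgV. Qed.

HB.instance Definition _ := isGroup.Build sequence_group
  sequence_mulA sequence_mul1 sequence_mulr1 sequence_mulV sequence_mulrV.
End SequenceGroup.

Lemma equinormal_subgroup : subgroup_set (equinormal : set sequence_group).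
Proof.
split=> [k|c d nc nd k|c nc k].
- by exists k, 0%N => n x _ Nx; rewrite invg1 conjg1.
- have [j [m H]] := nd k; have [j1 [m1 H1]] := nc j.
  have [j' [m' H']] := nc k; have [j1' [m1' H1']] := nd j'.
  exists (maxn j1 j1'), (maxn (maxn m m1) (maxn m' m1')) => n x.
  rewrite !geq_max => /andP[/andP[mn mn1] /andP[mn' mn1']] Nx; split.
    rewrite conjgM; apply: (H _ _ mn _).1; apply: (H1 _ _ mn1 _).1.
    by apply: nbhs_chain_mono Nx; exact: leq_maxl.
  rewrite invgM conjgM; apply: (H' _ _ mn' _).2; apply: (H1' _ _ mn1' _).2.
  by apply: nbhs_chain_mono Nx; exact: leq_maxr.
- have [j [m H]] := nc k; exists j, m => n x mn Nx.
  by have [] := H _ _ mn Nx; rewrite invgK.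
Qed.

Definition equinormal_group : groupType :=
  subgroup_type (subgroup_pred equinormal_subgroup).

(** Agreeing with [1] before rank [k] makes the topology Hausdorff even when the
    [N k] do not separate points, and removes the finitely many terms on which an
    equinormal sequence is not controlled; being in [N k] later on lets the
    truncations of a Cauchy sequence converge to it. *)
Definition sequence_ball k : set equinormal_group :=
  [set c | (forall n, (n < k)%N -> val c n = 1) /\ forall n, N k (val c n)].

Definition sequence_filter : set_system equinormal_group :=
  [set A | exists k, sequence_ball k `<=` A].

Lemma sequence_ball_mono i j : (i <= j)%N ->
  sequence_ball j `<=` sequence_ball i.
Proof.
move=> ij c [c1 cj]; split=> n; first by move=> /leq_trans ni; apply/c1/ni.
exact: nbhs_chain_mono (cj n).
Qed.

Lemma sequence_group_filter : group_filter sequence_filter.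
Proof.
split=> [|A|A|A|A g].
- split; first by exists 0%N.
    move=> A B [i iA] [j jB]; exists (maxn i j) => c cij; split.
      by apply/iA/(sequence_ball_mono _ cij)/leq_maxl.
    by apply/jB/(sequence_ball_mono _ cij)/leq_maxr.
  by move=> A B AB [k kA]; exists k => c /kA /AB.
- by move=> [k]; apply.
- move=> [k kA]; exists (sequence_ball k.+1); first by exists k.+1.
  move=> c d [c1 cN_] [d1 dN]; apply: kA; split=> n.
    move=> nk; rewrite [LHS](_ : _ = val c n * val d n) //.
    by rewrite c1 ?d1 ?mulg1 //; exact: leqW.
  exact: NM.
- move=> [k kA]; exists k => c [c1 cN_]; apply: kA; split=> n.
    by move=> /c1 cn; rewrite [LHS](_ : _ = (val c n)^-1) // cn invg1.
  exact: NV.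
- move=> [k kA]; have /asboolP /(_ k) [j [m gjm]] := valP g.
  exists (maxn k (maxn j m)) => c [c1 cN_]; apply: kA; split=> n.
    move=> nk; rewrite [LHS](_ : _ = val c n ^ val g n) // c1 ?conj1g //.
    by apply: (leq_trans nk); exact: leq_maxl.
  rewrite [X in N _ X](_ : _ = val c n ^ val g n) //.
  have [nm|mn] := ltnP n m.
    rewrite c1 ?conj1g //; apply: (leq_trans nm).
    by rewrite !leq_max leqnn !orbT.
  apply: (gjm _ _ mn _).1; apply: nbhs_chain_mono (cN_ n).
  by rewrite !leq_max leqnn !orbT.
Qed.

Lemma sequence_group_hausdorff :
  hausdorff_space (filter_group sequence_group_filter).
Proof.
apply: filter_group_hausdorff => c cn1.
have [n cn] : exists n, val c n <> 1.
  apply: contrapT => c1; apply: (negP cn1); apply/eqP/val_inj/funext => n.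
  by apply: contrapT => cn; apply: c1; exists n.
by exists (sequence_ball n.+1); [exists n.+1|move=> [/(_ n (ltnSn n)) /cn]].
Qed.

End NbhsChain.

Section CCompactComplete.
Variables (G : topologicalGroupType) (A : set G).
Variables (P : groupType) (N : nat -> set P) (cN : nbhs_chain N) (phi : G -> P).
Hypotheses (subA : subgroup_set A) (clA : closed A).
Hypothesis phiM : forall x y, A x -> A y -> phi (x * y) = phi x * phi y.
Hypothesis phiC : forall k, nbhs (1 : G) [set g | A g -> N k (phi g)].

Let H := filter_group (sequence_group_filter cN).

Definition limit_graph : set (G * H) :=
  [set p | A p.1 /\ chain_converges N (val (p.2 : equinormal_group cN)) (phi p.1)].

Lemma limit_graph_subgroup : subgroup_set limit_graph.
Proof.
case: (subA) => A1 AM AV; have NM := nbhs_chainM cN.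
split=> [|[g c] [h d] [/= Ag cg] [/= Ah dh]|[g c] [/= Ag cg]].
- split=> //= k; exists 0%N => n _.
  by rewrite (morph_on1 subA phiM) mulg1; apply: (nbhs_chainV cN); exact: (nbhs_chain1 cN).
- split=> /=; first exact: AM.
  move=> k; have /asboolP /(_ k.+1) [j [m dN]] := valP d.
  have [m1 H1] := cg j; have [m2 H2] := dh k.+1.
  exists (maxn m (maxn m1 m2)) => n; rewrite !geq_max => /and3P[mn m1n m2n].
  rewrite phiM // [X in N _ X](_ : _ =
    ((val c n)^-1 * phi g) ^ val d n * ((val d n)^-1 * phi h)); last first.
    rewrite [LHS](_ : _ = (val c n * val d n)^-1 * (phi g * phi h)) //.
    by rewrite conjgE invgM -!mulgA mulVKg.
  by apply: NM; [apply: (dN _ _ mn _).1; exact: H1|exact: H2].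
- split=> /=; first exact: AV.
  move=> k; have /asboolP /(_ k) [j [m cNj]] := valP c.
  have [m1 H1] := cg j; exists (maxn m m1) => n; rewrite geq_max => /andP[mn m1n].
  rewrite (morph_onV subA phiM) // [X in N _ X](_ : _ =
    (((val c n)^-1 * phi g) ^ (val c n)^-1)^-1).
    by apply: (nbhs_chainV cN); apply: (cNj _ _ mn _).2; exact: H1.
  rewrite [LHS](_ : _ = (val c n)^-1^-1 * (phi g)^-1) //.
  by rewrite conjgE !invgM !invgK -!mulgA mulgV mulg1.
Qed.

Lemma limit_graph_closed : closed limit_graph.
Proof.
case: (subA) => A1 AM AV [g c] clS.
have Ag : A g.
  apply: clA => B nB; have nC : nbhs (g, c) [set p : G * H | B p.1].
    by exists (B, setT) => /=; [split=> //; exact: filterT|move=> p []].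
  by have [[g' c'] [[/= Ag' _] Bg']] := clS _ nC; exists g'.
split=> //= k; set k3 := k.+2.
have nC : nbhs (g, c) [set p : G * H | (A (g^-1 * p.1) -> N k3 (phi (g^-1 * p.1)))
    /\ sequence_ball k3 ((c : equinormal_group cN)^-1 * p.2)].
  exists ([set g' | A (g^-1 * g') -> N k3 (phi (g^-1 * g'))],
          [set c' | sequence_ball k3 ((c : equinormal_group cN)^-1 * c')]) => //=.
  split.
    apply/nbhs_mulg; apply: filterS (phiC k3) => u /=.
    by rewrite mulKg.
  by apply/nbhs_filter_group; exists k3 => d /=; rewrite mulKg.
have [[g' c'] [[/= Ag' cg'] [/= gg' [_ cc']]]] := clS _ nC.
have Agg' : A (g^-1 * g') by apply: AM => //; exact: AV.
have [m Hm] := cg' k3; exists m => n mn.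
(* From [c n] to [c' n], to the limit [phi g'] of [c'], to [phi g]. *)
rewrite [X in N _ X](_ : _ = ((val c n)^-1 * val c' n) *
  ((val c' n)^-1 * phi g') * (phi (g^-1 * g'))^-1).
  apply: (nbhs_chainM3 cN); [exact: cc'|exact: Hm|].
  by apply: (nbhs_chainV cN); exact: gg'.
rewrite phiM ?(morph_onV subA phiM) //; last exact: AV.
by rewrite invgM invgK -!mulgA !mulVKg.
Qed.

(** The convergent sequences are the projection of the closed subgroup
    [limit_graph], hence closed among the equinormal ones; and a Cauchy sequence
    is a limit of its truncations, which are eventually constant. *)
Lemma c_compact_complete (x : nat -> P) : c_compact G ->
  (forall n, (phi @` A) (x n)) -> chain_cauchy N x ->
  exists2 g, A g & chain_converges N x (phi g).
Proof.
move=> cG Ax cx.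
have xE : (x : sequence_group P) \in subgroup_pred (equinormal_subgroup cN).
  exact/asboolP/cauchy_equinormal.
pose X : equinormal_group cN := Sub (x : sequence_group P) xE.
have := c_compact_closed_snd cG (sequence_group_hausdorff (cN := cN))
  limit_graph_subgroup limit_graph_closed.
move=> /(_ X) [|g [/= Ag]]; last by exists g.
move=> D /nbhs_filter_group [k kD].
have [m0 Hm0] := cx k; pose m := maxn k m0.
pose y : sequence_group P := fun n => x (minn n m).
have yE : y \in subgroup_pred (equinormal_subgroup cN).
  apply/asboolP/(cauchy_equinormal cN) => k'; exists m => i j mi mj.
  by rewrite /y !(minn_idPr _) // mulVg mulgV; split; exact: (nbhs_chain1 cN).
pose Y : equinormal_group cN := Sub y yE.
exists Y; split.
  have [g Ag gx] := Ax m; exists g; split=> //= k'; exists m => n mn.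
  rewrite gx [X in N _ X](_ : _ = (x (minn n m))^-1 * x m) //.
  by rewrite (minn_idPr _) // mulVg; exact: (nbhs_chain1 cN).
rewrite -[Y](mulVKg X); apply: kD.
have XY n : val (X^-1 * Y) n = (x n)^-1 * x (minn n m) by [].
split=> n.
  move=> nk; rewrite XY (minn_idPl _) ?mulVg //.
  by apply: (leq_trans (ltnW nk)); exact: leq_maxl.
rewrite XY; have [nm|mn] := leqP n m.
  by rewrite mulVg; exact: (nbhs_chain1 cN).
apply: (Hm0 _ _ _ _).1.
  by apply: leq_trans (ltnW mn); exact: leq_maxr.
exact: leq_maxr.
Qed.

End CCompactComplete.

(** * A Baire category theorem *)

Section Baire.
Variables (P : groupType) (N : nat -> set P) (cN : nbhs_chain N) (X : set P).
Hypotheses (subX : subgroup_set X) (NX : forall k, N k `<=` X).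
Hypothesis complete : forall x : nat -> P, (forall n, X (x n)) ->
  chain_cauchy N x -> exists2 l, X l & chain_converges N x l.
Variable C : nat -> set P.
Hypothesis coverX : X `<=` \bigcup_n C n.
Hypothesis closedC : forall n y, X y -> ~ C n y ->
  exists j, forall u, N j u -> ~ C n (y * u).

(** If no [C n] had an interior point in [X], one could move step by step, each
    time inside the previous neighbourhood and out of [C n], along a Cauchy
    sequence whose limit is in none of the [C n]. *)
Lemma baire : exists n x k, X x /\ forall u, N k u -> C n (x * u).
Proof.
apply: contrapT => nbaire.
have esc n x k : X x -> exists2 u, N k u & ~ C n (x * u).
  move=> Xx; apply: contrapT => nu; apply: nbaire; exists n, x, k; split=> // u Nu.
  by apply: contrapT => nC; apply: nu; exists u.
case: (subX) => X1 XM XV.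
(* From the position [x] with the radius [k], move at time [n] to [q.1] with the
   radius [q.2]. The third condition makes the sequence Cauchy on the right. Limits
   are only known to lie within radius [q.2.-1], whence the predecessor. *)
pose step (p : nat * (P * nat)) (q : P * nat) := X p.2.1 ->
  [/\ X q.1, N p.2.2.+1 (p.2.1^-1 * q.1), N p.1.+1 (q.1 * p.2.1^-1),
      (p.2.2 < q.2)%N & forall u, N q.2.-1 u -> ~ C p.1 (q.1 * u)].
have [f fP] : {f & forall p, step p (f p)}.
  apply: choice => -[n [x k]].
  have [Xx|nXx] := pselect (X x); last by exists (x, k).
  have [j jP] := nbhs_chainJ cN n.+1 x^-1.
  have [u Nu nCu] := esc n x (maxn j k.+1) Xx.
  have Xxu : X (x * u) by apply: XM => //; exact: NX Nu.
  have [i iP] := closedC Xxu nCu.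
  exists (x * u, (maxn k i).+1) => _ /=; split=> //.
  - by rewrite mulKg; apply: (nbhs_chain_mono cN) Nu; exact: leq_maxr.
  - rewrite [X in N _ X](_ : _ = u ^ x^-1); last by rewrite conjgE invgK mulgA.
    by apply: jP; apply: (nbhs_chain_mono cN) Nu; exact: leq_maxl.
  - by rewrite ltnS leq_maxl.
  - by move=> v Nv; apply: iP; apply: (nbhs_chain_mono cN) Nv; exact: leq_maxr.
pose s := fix s n : P * nat := if n is n'.+1 then f (n', s n') else (1, 0%N).
have Xs n : X (s n).1.
  by elim: n => // n Xn; have [] := fP (n, s n) Xn.
have sP n := fP (n, s n) (Xs n).
have kn n : (n <= (s n).2)%N.
  by elim: n => // n IH; apply: leq_ltn_trans IH _; have [] := sP n.
have left n d : N (s n).2 ((s n).1^-1 * (s (n + d)%N).1).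
  elim: d n => [|d IH] n; first by rewrite addn0 mulVg; exact: (nbhs_chain1 cN).
  rewrite addnS -addSn (mulg_insert (s n.+1).1).
  have [_ H1 _ H2 _] := sP n.
  apply: (nbhs_chainM cN) => //.
  by apply: (nbhs_chain_mono cN H2); exact: (IH n.+1).
have right n d : N n ((s (n + d)%N).1 * (s n).1^-1).
  elim: d n => [|d IH] n; first by rewrite addn0 mulgV; exact: (nbhs_chain1 cN).
  rewrite addnS -addSn -(divgKA (s n.+1).1).
  have [_ _ H1 _ _] := sP n.
  by apply: (nbhs_chainM cN) => //; exact: (IH n.+1).
have cs : chain_cauchy N (fun n => (s n).1).
  move=> k; exists k.+1 => i j /subnKC <- /subnKC <-; split.
    rewrite (mulg_insert (s k.+1).1).
    apply: (nbhs_chainM cN); apply: (nbhs_chain_mono cN (kn k.+1)) => //.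
    by rewrite -[X in N _ X]invgK invgM invgK; apply: (nbhs_chainV cN).
  rewrite -(divgKA (s k.+1).1).
  apply: (nbhs_chainM cN) => //.
  by rewrite -[X in N _ X]invgK invgM invgK; apply: (nbhs_chainV cN).
have [l Xl sl] := complete Xs cs.
have [n _ Cnl] := coverX Xl.
have [_ _ _ lt_k nC] := sP n; apply: (nC ((s n.+1).1^-1 * l)); last first.
  by rewrite mulVKg.
set k := (s n.+1).2 in lt_k nC *; have [m Hm] := sl k.
have -> : (s n.+1).1^-1 * l = ((s n.+1).1^-1 * (s (n.+1 + m)%N).1)
    * ((s (n.+1 + m)%N).1^-1 * l) by rewrite -mulgA mulVKg.
have kS : k = k.-1.+1 by rewrite prednK //; exact: leq_ltn_trans lt_k.
apply: (nbhs_chainM cN); rewrite -kS; first exact: left.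
by apply: Hm; exact: leq_addl.
Qed.

End Baire.

(** * Countable discrete subquotients of c-compact groups *)

(** The neighbourhoods of [1] for [tau], in terms of the group law of [P]. *)
Lemma topologized_group_filter (P : groupType) (tau : topology_on P) :
  is_group_topology tau -> hausdorff_space (topologized tau) ->
  exists F : set_system P, [/\ group_filter F,
    forall (x : P) (A : set P),
      @nbhs _ (topologized tau) x A <-> F [set g | A (x * g)] &
    forall p : P, p != 1 -> exists2 U, F U & ~ U p].
Proof.
move=> tauG hP; exists (@nbhs _ (topologized tau) 1).
(* The group laws of [P] and of [topologized tau] become convertible when [P] is in
   constructor form. *)
case: P tau tauG hP => T [? ? ? ? ? ? ? ? ?] tau tauG hP; split.
- exact: nbhs1_group_filter (topological_group tauG).
- exact: @nbhs_mulg (topological_group tauG).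
- by move=> p; exact: (@hausdorff_sep (topological_group tauG)).
Qed.

(** A Hausdorff group topology on a countable group is finer than a Hausdorff
    group topology with a countable base at [1]: the [k]-th neighbourhood takes
    care of conjugation by the elements of rank at most [k], and separates them
    from [1]. *)
Lemma countable_group_nbhs_chain (T : groupType) (F : set_system T)
    (f : T -> nat) :
  group_filter F -> injective f ->
  (forall p, p != 1 -> exists2 U, F U & ~ U p) ->
  exists N : nat -> set T, [/\ nbhs_chain N, forall k, F (N k) &
    forall p, p != 1 -> exists k, ~ N k p].
Proof.
move=> gT injf sepF; have FF := group_filter_filter gT.
have avoid (U : set T) m : F U -> exists2 V, F V &
    forall g, (f g < m)%N -> (forall x, V x -> U (x ^ g)) /\ (g != 1 -> ~ V g).
  move=> U1; elim: m => [|m [V V1 VP]]; first by exists setT => //; exact: filterT.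
  (* At most one element has rank [m]. *)
  have [[g fg]|ng] := pselect (exists g, f g = m); last first.
    exists V => // g; rewrite ltnS leq_eqVlt => /orP[/eqP fg|/VP//].
    by case: ng; exists g.
  have [W W1 nWg] : exists2 W, F W & (g != 1 -> ~ W g).
    have [->|gn1] := eqVneq g 1; first by exists setT => //; exact: filterT.
    by have [W W1 nWg] := sepF _ gn1; exists W.
  exists (V `&` W `&` [set x | U (x ^ g)]).
    by apply: filterI; [exact: filterI|exact: (group_filterJ gT)].
  move=> h; rewrite ltnS leq_eqVlt => /orP[/eqP fh|/VP [H1 H2]].
    have -> : h = g by apply: injf; rewrite fg.
    by split=> [x [_ Ux]//|/nWg nW [[_ /nW]]].
  by split=> [x [[/H1]]//|/H2 nV [[/nV]]].
pose R (p : nat * set T) (V : set T) := F p.2 ->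
  [/\ F V, forall x, V x -> V x^-1,
      forall x y, V x -> V y -> p.2 (x * y) &
      forall g, (f g <= p.1)%N ->
        (forall x, V x -> p.2 (x ^ g)) /\ (g != 1 -> ~ V g)].
have [next nextP] : {next & forall p, R p (next p)}.
  apply: choice => -[m U]; have [U1|] := pselect (F U); last by exists U.
  have [V V1 VV] := group_filterM gT U1; have [W W1 WP] := avoid U m.+1 U1.
  pose D := V `&` W; have D1 : F D by exact: filterI.
  exists (D `&` [set x | D x^-1]) => _; split=> /=.
  - by apply: filterI => //; exact: (group_filterV gT).
  - by move=> x [? ?]; split=> //=; rewrite invgK.
  - by move=> x y [[Vx _] _] [[Vy _] _]; exact: VV.
  - move=> g /WP [H1 H2]; split=> [x [[_ /H1//]]|/H2 nW [[_ /nW//]]].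
pose N := fix N n : set T := if n is n'.+1 then next (n', N n') else setT.
have N1 k : F (N k).
  by elim: k => [|k IH]; [exact: filterT|have [] := nextP (k, N k) IH].
have NP k := nextP (k, N k) (N1 k).
have Nmono i j : (i <= j)%N -> N j `<=` N i.
  move=> /subnK <-; elim: (j - i)%N => // k IH x Nx; apply: IH.
  have [_ _ M _] := NP (k + i)%N; rewrite -[x]mulg1; apply: M => //.
  apply: (group_filter1 gT); exact: (N1 (k + i)%N.+1).
exists N; split=> //; last first.
  move=> p pn1; exists (f p).+1.
  by have [_ _ _ /(_ p (leqnn _)) [_ /(_ pn1)]] := NP (f p).
split.
- by move=> k; apply: (group_filter1 gT); exact: (N1 k).
- by move=> [//|k] x; have [_ V _ _] := NP k; exact: V.
- by move=> k x y; have [_ _ M _] := NP k; exact: M.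
- move=> k g; pose i := maxn k (f g); exists i.+1 => x Nx.
  apply: (Nmono k i); first exact: leq_maxl.
  by have [_ _ _ /(_ g (leq_maxr _ _)) [H _]] := NP i; exact: H.
Qed.

Section LocallyConstantImage.
Variables (G : topologicalGroupType) (cG : c_compact G).

(** A coarser topology with a countable base is complete because [G] is
    c-compact; [P] is a countable union of points, so Baire's theorem makes one
    of them open. *)
Lemma locally_constant_image_non_topologizable (A : set G) (P : groupType)
    (phi : G -> P) : subgroup_set A -> closed A ->
  (forall x y, A x -> A y -> phi (x * y) = phi x * phi y) ->
  nbhs (1 : G) [set g | A g -> phi g = 1] ->
  (forall p, (phi @` A) p) -> countable [set: P] -> non_topologizable P.
Proof.
move=> subA clA phiM phi1 surj cP tau tauG hP.
have [f injf] : exists f : P -> nat, injective f.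
  by have /countable_injP [f fP] := cP; exists f => x y; apply: fP; rewrite inE.
have [F [gF nbhsF sepF]] := topologized_group_filter tauG hP.
have FF := group_filter_filter gF.
have [N [cN N1 Nsep]] := countable_group_nbhs_chain gF injf sepF.
have complete (x : nat -> P) : (forall n, [set: P] (x n)) ->
    chain_cauchy N x -> exists2 l, [set: P] l & chain_converges N x l.
  move=> _ cx.
  have phiC k : nbhs (1 : G) [set g | A g -> N k (phi g)].
    by apply: filterS phi1 => g /[apply] ->; exact: (nbhs_chain1 cN).
  have [g Ag xg] := c_compact_complete cN subA clA phiM phiC cG
    (fun n => surj (x n)) cx.
  by exists (phi g).
have [|||n y _ fyn|n [x [k [_ xN]]]] :=
  @baire P N cN setT _ _ complete (fun n => [set p | f p = n]) _ _ => //.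
- by move=> p _; exists (f p).
- have [[p fp]|np] := pselect (exists p, f p = n); last first.
    by exists 0%N => u _ fu; apply: np; exists (y * u).
  have [|j nNj] := Nsep (y^-1 * p).
    by apply/eqP => yp; apply: fyn; rewrite -fp -[p](mulVKg y) yp mulg1.
  exists j => u Nu fyu; apply: nNj; rewrite -(_ : y * u = p) ?mulKg //.
  by apply: injf; rewrite fp.
have o1 : F [set 1].
  apply: filterS (N1 k) => u Nu; have := xN _ Nu; rewrite -(xN 1 (nbhs_chain1 cN k)).
  by move=> /injf /mulgI.
move=> A'; rewrite -open_topologizedE openE => p Ap.
apply/nbhsF; apply: filterS o1 => _ -> /=.
by rewrite mulg1.
Qed.

(** A subquotient of [P] is again a locally constant image, of the part of [A]
    that lies over the subgroup. *)
Lemma locally_constant_image_hereditary (A : set G) (P : groupType)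
    (phi : G -> P) : subgroup_set A -> closed A ->
  (forall x y, A x -> A y -> phi (x * y) = phi x * phi y) ->
  nbhs (1 : G) [set g | A g -> phi g = 1] ->
  (forall p, (phi @` A) p) -> countable [set: P] ->
  hereditarily_non_topologizable P.
Proof.
move=> subA clA phiM phi1 surj cP B N.
pose A' := [set g | A g /\ phi g \in B].
pose psi g : quotient_group N :=
  if insub (phi g) is Some u then (\pi_(quotient_group N) (u : subgroup_type B))%qT
  else 1.
have psiE g (u : subgroup_type B) :
    val u = phi g -> psi g = (\pi_(quotient_group N) u)%qT.
  by move=> ug; rewrite /psi -ug valK.
have lift g : A' g -> exists u : subgroup_type B, val u = phi g.
  by move=> [_ gB]; exists (Sub (phi g) gB); rewrite SubK.
case: (subA) => A1 AM AV.
apply: (@locally_constant_image_non_topologizable A' _ psi).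
- split=> [|x y [Ax xB] [Ay yB]|x [Ax xB]]; split=> //.
  + by rewrite (morph_on1 subA phiM); exact: gpred1.
  + exact: AM.
  + by rewrite phiM //; exact: gpredM.
  + exact: AV.
  + by rewrite (morph_onV subA phiM) // gpredV.
- move=> g clg; have Ag : A g.
    by apply: clA => D /clg [x [[Ax _] Dx]]; exists x.
  have [g' [Ag' gB'] /=] := closure_mulg clg phi1.
  have Agg' : A (g^-1 * g') by apply: AM => //; exact: AV.
  move=> /(_ Agg') eg; split=> //.
  by rewrite -[phi g]mulg1 -eg -phiM // mulVKg.
- move=> x y A'x A'y; have [u ux] := lift _ A'x; have [v vy] := lift _ A'y.
  rewrite (psiE _ _ ux) (psiE _ _ vy) (psiE _ (u * v)); first exact/esym/quot_mulE.
  rewrite phiM; [|by case: A'x|by case: A'y].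
 by rewrite -ux -vy.
- apply: filterS phi1 => g H [Ag _]; rewrite (psiE _ 1) //.
  by rewrite H.
- elim/quotW => u; have [g Ag gu] := surj (val u).
  exists g; last exact: psiE.
  by split=> //; rewrite gu; exact: (valP u).
- have /countable_injP [f fP] := cP; apply/countable_injP.
  exists (fun q : quotient_group N => f (val (repr q))) => p q _ _ /fP.
  rewrite !inE => /(_ I I) /val_inj pq.
  by rewrite -[p]reprK -[q]reprK pq.
Qed.

Hypothesis finite_hereditarily_non_topologizable : forall P : groupType,
  countable [set: P] -> hereditarily_non_topologizable P ->
  finite_set [set: P].

(** The quotient of [A] by [A `&` L] is a countable locally constant image of
    [A]. *)
Lemma countable_index_finite (A L : set G) (I : countType) (x : I -> G) :
  subgroup_set A -> closed A -> subgroup_set L ->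
  (forall l g, A g -> L l -> L (l ^ g)) ->
  nbhs (1 : G) [set g | A g -> L g] ->
  (forall g, A g -> exists2 i, A (x i) & L ((x i)^-1 * g)) ->
  exists s : seq G, forall g, A g -> exists2 y, y \in s & L (y^-1 * g).
Proof.
move=> subA clA subL nL L1 Ax; case: (subA) => A1 AM AV.
pose phi := to_subquotient subA subL nL.
have phi_eq y z : A y -> A z -> phi y = phi z <-> L (y^-1 * z).
  exact: to_subquotient_eq.
have phi_surj q : exists2 y, A y & phi y = q by exact: to_subquotient_surj.
have : finite_set [set: subquotient subA subL nL].
  have cQ : countable [set: subquotient subA subL nL].
    have [i iP] : {i & forall q, phi (x (i q)) = q}.
      apply: (@choice _ _ (fun q i => phi (x i) = q)) => q; have [g Ag <-] := phi_surj q.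
      by have [i Ai Li] := Ax g Ag; exists i; apply/phi_eq.
    apply/countable_injP; exists (fun q => pickle (i q)) => p q _ _.
    by move=> /(pcan_inj (@pickleK I)) e; rewrite -[p]iP -[q]iP e.
  apply: finite_hereditarily_non_topologizable => //.
  apply: (@locally_constant_image_hereditary A _ phi) => //.
    by move=> y z; exact: to_subquotientM.
  apply: filterS L1 => g /= AL Ag.
  rewrite -(morph_on1 subA (@to_subquotientM _ _ _ subA subL nL)).
  apply/esym/phi_eq => //; rewrite invg1 mul1g; exact: AL.
move=> /finite_seqP [t tT].
have [r rP] : {r & forall q, A (r q) /\ phi (r q) = q}.
  apply: (@choice _ _ (fun q y => A y /\ phi y = q)) => q.
  by have [y Ay yq] := phi_surj q; exists y.
exists (map r t) => g Ag; exists (r (phi g)).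
  apply/mapP; exists (phi g) => //.
  by have : [set` t] (phi g) by rewrite -tT.
by apply/phi_eq => //; case: (rP (phi g)).
Qed.

End LocallyConstantImage.

(** * Subgroups of finite index and monothetic subgroups *)

Lemma injective_nat_not_in_seq (T : eqType) (s : seq T) (c : nat -> T) :
  injective c -> ~ forall n, c n \in s.
Proof.
move=> injc cs.
have : (size (map c (iota 0 (size s).+1)) <= size s)%N.
  apply: uniq_leq_size; first by rewrite map_inj_uniq ?iota_uniq.
  by move=> _ /mapP [n _ ->].
by rewrite size_map size_iota ltnn.
Qed.

Section FiniteIndex.
Variables (G : topologicalGroupType) (cG : c_compact G).
Hypothesis finite_hereditarily_non_topologizable : forall P : groupType,
  countable [set: P] -> hereditarily_non_topologizable P ->
  finite_set [set: P].

(** Otherwise choose infinitely many cosets of [L]; with [L], they generate an open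
    subgroup [A], in which [L] has countable but infinite index. *)
Lemma open_normal_index_finite (L : set G) : subgroup_set L ->
  nbhs (1 : G) L -> (forall l g, L l -> L (l ^ g)) ->
  exists s : seq G, forall g, exists2 y, y \in s & L (y^-1 * g).
Proof.
move=> subL L1 nL; case: (subL) => L_1 LM LV; apply: contrapT => infL.
have [F FP] : {F & forall s : seq G, forall y, y \in s -> ~ L (y^-1 * F s)}.
  apply: (@choice _ _ (fun (s : seq G) g => forall y, y \in s -> ~ L (y^-1 * g))).
  move=> s; apply: contrapT => ns; apply: infL; exists s => g.
  apply: contrapT => ng; apply: ns; exists g => y ys Ly; apply: ng.
  by exists y.
pose t := fix t n : seq G := if n is n'.+1 then F (t n') :: t n' else [::].
pose y n := F (t n).
have yt m n : (m < n)%N -> y m \in t n.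
  elim: n => // n IH; rewrite ltnS leq_eqVlt inE => /orP[/eqP ->|/IH ->].
    by rewrite eqxx.
  by rewrite orbT.
pose word (w : seq (bool * nat)) : G :=
  \prod_(p <- w) (if p.1 then y p.2 else (y p.2)^-1).
have wordV w : exists w', word w' = (word w)^-1.
  elim: w => [|[b n] w [w' IH]]; first by exists [::]; rewrite /word big_nil invg1.
  exists (rcons w' (~~ b, n)); rewrite -cats1 /word big_cat big_seq1 big_cons /=.
  rewrite invgM; congr (_ * _); first exact: IH.
  by case: b; rewrite ?mulg1 ?mul1g ?invgK.
pose A : set G := [set g | exists w, L ((word w)^-1 * g)].
have LA : L `<=` A by move=> l Ll; exists [::]; rewrite /word big_nil invg1 mul1g.
have subA : subgroup_set A.
  split; first exact: LA.
  - move=> g h [w Lg] [v Lh]; exists (w ++ v).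
    rewrite (_ : _ * _ = ((word w)^-1 * g) ^ word v * ((word v)^-1 * h)).
      by apply: LM => //; exact: nL.
    rewrite /word big_cat /= -/(word w) -/(word v) invgM conjgE.
    by rewrite -!mulgA mulVKg.
  - move=> g [w Lg]; have [w' w'E] := wordV w; exists w'.
    rewrite w'E invgK (_ : _ * _ = (((word w)^-1 * g) ^ (word w)^-1)^-1).
      by apply: LV; exact: nL.
    by rewrite conjgE !invgM !invgK -!mulgA mulgV mulg1.
have A1 : nbhs (1 : G) A by apply: filterS L1.
have [||s sP] := countable_index_finite cG finite_hereditarily_non_topologizable
    subA (open_subgroup_closed subA A1) subL (fun l g _ => nL l g)
    (filterS _ L1) (x := word).
- by move=> l Ll _.
- move=> g [w Lw]; exists w => //; exists w; by rewrite mulVg.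
have yA n : A (y n).
  by exists [:: (true, n)]; rewrite /word big_seq1 mulVg.
have [c cP] : {c & forall n, c n \in s /\ L ((c n)^-1 * y n)}.
  apply: (@choice _ _ (fun n z => z \in s /\ L (z^-1 * y n))) => n.
  by have [z zs Lz] := sP _ (yA n); exists z.
have disj m n : (m < n)%N -> c m <> c n.
  move=> mn cmn; apply: (FP (t n) (y m) (yt _ _ mn)).
  have [[_ Lm] [_ Ln]] := (cP m, cP n).
  rewrite -/(y n) (mulg_insert (c n)); apply: LM => //.
  by rewrite -[_ * _]invgK invgM invgK -cmn; exact: LV.
apply: (@injective_nat_not_in_seq _ s c); last by move=> n; case: (cP n).
by move=> m n cmn; case: (ltngtP m n) => // /disj; rewrite cmn.
Qed.

(** Otherwise [f] generates a discrete, hence closed, infinite cyclic subgroup,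
    which contradicts [countable_index_finite] with the trivial subgroup. *)
Lemma powers_recurrent (f : G) (U : set G) (j : nat) :
  hausdorff_space G -> nbhs (1 : G) U -> exists2 n, (j <= n)%N & U (f ^+ n).
Proof.
move=> hG U1; apply: contrapT => nex.
have nU n : (j <= n)%N -> ~ U (f ^+ n) by move=> jn Un; apply: nex; exists n.
have gG := nbhs1_group_filter G.
have fn1 n : (0 < n)%N -> f ^+ n != 1.
  move=> n0; apply/eqP => fn; apply: (nU (n * j)%N); first exact: leq_pmull.
  by rewrite expgnA fn expg1n; exact: nbhs_singleton.
have injf : injective (fun n => f ^+ n).
  have H m n : (m < n)%N -> f ^+ m <> f ^+ n.
    move=> mn e; have := fn1 (n - m)%N; rewrite subn_gt0 => /(_ mn) /eqP; apply.
    by rewrite (expgnFr _ (ltnW mn)) e mulgV.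
  by move=> m n e; case: (ltngtP m n) => // /H; rewrite e.
pose D : set G := [set x | exists n, x = f ^+ n \/ x = f ^- n].
have DV x : D x -> D x^-1.
  by move=> [n [->|->]]; exists n; [right|left; rewrite invgK].
have Dp m n : D (f ^+ m * f ^- n).
  have [mn|nm] := leqP m n; last by exists (m - n)%N; left; rewrite (expgnFr _ (ltnW nm)).
  by exists (n - m)%N; right; rewrite (expgnFr _ mn) invgM invgK.
have subD : subgroup_set D.
  split=> //; first by exists 0%N; left.
  move=> x y [m [->|->]] [n [->|->]].
  - by exists (m + n)%N; left; rewrite expgnDr.
  - exact: Dp.
  - have -> : f ^- m * f ^+ n = f ^+ n * f ^- m.
      by apply/commute_sym/commuteV; exact: commuteX2.
    exact: Dp.
  - by exists (n + m)%N; right; rewrite expgnDr invgM.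
have [W W1 DW] : exists2 W, nbhs (1 : G) W & D `&` W `<=` [set 1].
  have [W W1 WP] : exists2 W, nbhs (1 : G) W &
      forall n, (0 < n < j)%N -> ~ W (f ^+ n).
    elim: (j) => [|m [W W1 WP]].
      by exists setT => [|n]; [exact: filterT|rewrite ltn0 andbF].
    have [->|m0] := posnP m.
      by exists setT => [|[]//]; exact: filterT.
    have [V V1 nV] := hausdorff_sep hG (fn1 _ m0).
    exists (W `&` V); first exact: filterI.
    move=> n; rewrite ltnS [(n <= m)%N]leq_eqVlt => /andP[n0 /orP[/eqP ->|nm]] [Wn Vn] //.
    by apply: (WP n) => //; rewrite n0.
  pose E := W `&` U.
  have E1 : nbhs (1 : G) E by exact: filterI.
  have nE n : (0 < n)%N -> ~ E (f ^+ n).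
    by move=> n0 [Wn Un]; have [nj|/nU//] := ltnP n j; apply: (WP n) => //; rewrite n0.
  exists (E `&` [set x | E x^-1]); first by apply: filterI => //; exact: (group_filterV gG).
  move=> x [[n fn] [Ex Ex']]; case: (posnP n) => [n0|/nE n0].
    by case: fn => ->; rewrite n0 //= invg1.
  by case: fn => fx; case: n0; [rewrite -fx|rewrite -[f ^+ n]invgK -fx].
have cl1 : closed [set (1 : G)].
  by apply: accessible_closed_set1; exact: hausdorff_accessible.
have clD : closed D.
  apply: (locally_closed_subgroup_closed subD _ cl1 W1 DW).
  by move=> _ ->; exists 0%N; left.
have sub1 : subgroup_set [set (1 : G)].
  by split=> [//|x y -> ->|x ->]; rewrite /= ?mulg1 ?invg1.
have [|||s sP] := @countable_index_finite G cG finite_hereditarily_non_topologizable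
  D [set 1] (bool * nat)%type (fun p => if p.1 then f ^+ p.2 else f ^- p.2) subD clD sub1.
- by move=> l g _ ->; rewrite /= conj1g.
- by apply: filterS W1 => x Wx Dx; exact: DW.
- move=> _ [n [->|->]]; [exists (true, n)|exists (false, n)] => /=; rewrite ?mulVg //.
    by exists n; left.
  by exists n; right.
apply: (injective_nat_not_in_seq injf (s := s)) => n.
have [|y ys /= yf] := sP (f ^+ n); first by exists n; left.
by rewrite (_ : f ^+ n = y) // -[RHS]mulg1 -yf mulVKg.
Qed.

(** By recurrence and compactness, each point of [V `&` M] returns to [V] under a
    power of [f] with exponent between [1] and some bound [m]. A power of [f] which
    is in [f ^+ i V] with [m < i] is therefore in [f ^+ (i - j) V] for some
    positive [j <= m]; so the translates [f ^+ i V] with [i <= m] cover [M]. *)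
Lemma monothetic_compact (f : G) (V : set G) :
  hausdorff_space G -> nbhs (1 : G) V -> compact V ->
  compact (closure [set f ^+ n | n in [set: nat]]).
Proof.
move=> hG V1 cV; set M := closure _; have gG := nbhs1_group_filter G.
have return_time x : M x -> exists j, (0 < j)%N /\ nbhs (f ^+ j * x) V.
  move=> Mx; have /(group_filterM gG) [W W1 WV] : nbhs (1 : G) V° by exact: nbhs_interior.
  have [_ [n _ <-] Wn] := closure_mulg Mx (group_filterV gG W1).
  have [m nm Wm] := powers_recurrent f n.+1 hG W1.
  exists (m - n)%N; split; first by rewrite subn_gt0.
  have := WV _ _ Wm Wn; rewrite invgM invgK mulgA.
  by rewrite -(expgnFr _ (ltnW nm)).
have [j jP] : {j & forall x, M x -> (0 < j x)%N /\ nbhs (f ^+ j x * x) V}.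
  apply: (@choice _ _ (fun x j => M x -> (0 < j)%N /\ nbhs (f ^+ j * x) V)) => x.
  by have [/return_time [j jP]|nM] := pselect (M x); [exists j|exists 0%N].
have cVM : compact (V `&` M) by apply: compact_closedI => //; exact: closed_closure.
have [|s sVM sP] := @compact_finite_cover _ (V `&` M)
    (fun x => [set y | V (f ^+ j x * y)]) cVM.
  by move=> x [_ /jP [_ Vx]]; exact: mulgl_continuous Vx.
pose m := \max_(x <- s) j x.
have cover n : exists2 i, (i <= m)%N & V ((f ^+ i)^-1 * f ^+ n).
  have exP : exists i, `[< V ((f ^+ i)^-1 * f ^+ n) >].
    by exists n; apply/asboolP; rewrite mulVg; exact: nbhs_singleton.
  case: (ex_minnP exP) => i /asboolP Vi imin; exists i => //.
  rewrite leqNgt; apply/negP => mi.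
  have ni : (i <= n)%N.
    by apply: imin; apply/asboolP; rewrite mulVg; exact: nbhs_singleton.
  have [|x xs Vx] := sP ((f ^+ i)^-1 * f ^+ n).
    split=> //; apply: subset_closure; exists (n - i)%N => //.
    by rewrite -{2}(subnKC ni) expgnDr mulKg.
  have [j0 _] := jP x (sVM x xs).2.
  have jm : (j x <= m)%N by exact: leq_bigmax_seq.
  have ji := leq_ltn_trans jm mi.
  have /imin : `[< V ((f ^+ (i - j x)%N)^-1 * f ^+ n) >].
    apply/asboolP; rewrite (expgnFr _ (ltnW ji)) invgM invgK.
    by rewrite -mulgA.
  by rewrite leqNgt ltn_subrL j0 (leq_ltn_trans _ ji).
have cK : compact (mulset [set f ^+ i | i in `I_m.+1] V).
  apply: mulset_compact => //; apply: finite_compact.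
  exact/finite_image/finite_II.
apply: (subclosed_compact (@closed_closure _ _) cK).
rewrite [X in _ `<=` X]((closure_id _).1 (compact_closed hG cK)).
apply: closureS => _ [n _ <-]; have [i im Vi] := cover n.
by exists (f ^+ i); [exists i|exists ((f ^+ i)^-1 * f ^+ n) => //; rewrite mulVKg].
Qed.

End FiniteIndex.

(** * Locally compact c-compact groups with small invariant neighbourhoods *)

Section Continuity.
Variable G : topologicalGroupType.

Lemma continuous_mulg (f h : G -> G) : continuous f -> continuous h ->
  continuous (fun x => f x * h x).
Proof.
move=> cf ch x.
apply: (@cvg_comp _ _ _ (fun x => (f x, h x)) (fun p => p.1 * p.2) _ (nbhs (f x, h x))).
  by apply: cvg_pair; [exact: cf | exact: ch].
exact: (@mulg_continuous G (f x, h x)).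
Qed.

Lemma continuous_conjg (g : G) : continuous (fun x : G => x ^ g).
Proof.
move=> x; apply: continuous_mulg => y; first exact: cvg_cst.
exact: mulgr_continuous.
Qed.

Lemma continuous_commg (v : G) : continuous (fun x : G => [~ x, v]).
Proof.
move=> x; apply: continuous_mulg => y; first exact: invg_continuous.
exact: continuous_conjg.
Qed.

Lemma closed_preimage (f : G -> G) (A : set G) : continuous f -> closed A ->
  closed (f @^-1` A).
Proof. by move=> /continuous_closedP; apply. Qed.

Lemma closure_image (f : G -> G) (A B : set G) : continuous f ->
  (forall x, A x -> B (f x)) -> forall x, closure A x -> closure B (f x).
Proof.
move=> cf AB x clx D /cf /clx [y [Ay Dy]].
by exists (f y); split=> //; exact: AB.
Qed.

End Continuity.

(** The closure of an invariant symmetric neighbourhood [V'] is contained in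
    [V' V'], so small invariant neighbourhoods can be taken closed. *)
Lemma invariant_nbhs_chain (G : topologicalGroupType) (V0 : set G) :
  small_invariant_nbhs G -> nbhs (1 : G) V0 ->
  exists U : nat -> set G, [/\ nbhs_chain U, forall k, nbhs (1 : G) (U k),
    forall k, closed (U k), forall k g x, U k x -> U k (x ^ g) & U 0%N `<=` V0].
Proof.
move=> sin V01; have gG := nbhs1_group_filter G.
pose good (W U : set G) := [/\ nbhs (1 : G) U /\ closed U,
  forall x, U x -> U x^-1, forall g x, U x -> U (x ^ g) &
  forall x y, U x -> U y -> W (x * y)].
have step W : nbhs (1 : G) W -> exists U, good W U.
  move=> /(group_filterM gG) [D /(group_filterM gG) [E /sin [V [V1 VE VJ]] ED] DW].
  have {}VJ g x : V x -> V (x ^ g) by move=> Vx; rewrite -(VJ g); exists x.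
  pose V' := V `&` [set x | V x^-1].
  have V'1 : nbhs (1 : G) V' by apply: filterI => //; exact: (group_filterV gG).
  have V'V x : V' x -> V' x^-1 by move=> [Vx Vx']; split=> //=; rewrite invgK.
  have clD : closure V' `<=` D.
    move=> x /closure_mulg /(_ V'1) [a V'a V'x].
    rewrite -[x]invgK -[x^-1](mulgK a) invgM invgK.
    by apply: ED; apply: VE; [case: V'a|case: (V'V _ V'x)].
  exists (closure V'); split.
  - by split; [apply: filterS V'1; exact: subset_closure|exact: closed_closure].
  - exact: (closure_image (@invg_continuous G) V'V).
  - move=> g; apply: (closure_image (@continuous_conjg G g)) => x [Vx Vx'].
    by split; [exact: VJ|rewrite /= -conjVg; exact: VJ].
  - by move=> x y /clD Dx /clD; exact: DW.
have [F FP] : {F & forall W, nbhs (1 : G) W -> good W (F W)}.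
  apply: (@choice _ _ (fun W U => nbhs (1 : G) W -> good W U)) => W.
  by have [/step [U gU]|nW] := pselect (nbhs (1 : G) W); [exists U|exists setT].
pose U := fix U n := F (if n is n'.+1 then U n' else V0).
have U1 k : nbhs (1 : G) (U k).
  by elim: k => [|k IH]; [have [[]] := FP _ V01|have [[]] := FP _ IH].
have UP k : good (if k is k'.+1 then U k' else V0) (U k).
  by case: k => [|k]; apply: FP.
have UJ k g x : U k x -> U k (x ^ g) by have [_ _ J _] := UP k; exact: J.
exists U; split=> //.
- split=> [k|k x|k x y|k g].
  + exact: nbhs_singleton (U1 k).
  + by have [_ V _ _] := UP k; exact: V.
  + by have [_ _ _ M] := UP k.+1; exact: M.
  + by exists k; exact: UJ.
- by move=> k; have [[]] := UP k.
- move=> x Ux; rewrite -[x]mulg1; have [_ _ _ M] := UP 0%N; apply: M => //.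
  exact: nbhs_singleton (U1 0%N).
Qed.

Section CompactlyGenerated.
Variables (G : topologicalGroupType) (U : nat -> set G).
Hypotheses (hG : hausdorff_space G) (cG : c_compact G).
Hypotheses (cU : nbhs_chain U) (U1 : forall k, nbhs (1 : G) (U k)).
Hypotheses (clU : forall k, closed (U k)).
Hypothesis UJ : forall k g x, U k x -> U k (x ^ g).
Hypothesis cptU : compact (U 0).
Hypothesis finite_hereditarily_non_topologizable : forall P : groupType,
  countable [set: P] -> hereditarily_non_topologizable P ->
  finite_set [set: P].

Let V : set G := U 0.
Let V1 : V 1. Proof. exact: (nbhs_chain1 cU). Qed.
Let VV x : V x -> V x^-1. Proof. exact: (nbhs_chainV cU). Qed.

Fixpoint generator_power n : set G :=
  if n is n'.+1 then mulset V (generator_power n') else [set 1].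

Definition generated_subgroup : set G := [set x | exists n, generator_power n x].
Notation L := generated_subgroup.

Lemma generator_powerD m n x y : generator_power m x -> generator_power n y ->
  generator_power (m + n) (x * y).
Proof.
move=> + Yy; elim: m x => [x ->|m IH _ [v Vv [x Xx <-]]]; first by rewrite mul1g.
by rewrite addSn -mulgA; exists v => //; exists (x * y) => //; exact: IH.
Qed.

Lemma generator_powerV n x : generator_power n x -> generator_power n x^-1.
Proof.
elim: n x => [x ->|n IH _ [v Vv [x Xx <-]]]; first exact: invg1.
rewrite invgM -addn1; apply: generator_powerD; first exact: IH.
by exists v^-1; [exact: VV|exists 1; rewrite ?mulg1].
Qed.

Lemma generator_powerJ n g x : generator_power n x -> generator_power n (x ^ g).
Proof.
elim: n x => [x ->|n IH _ [v Vv [x Xx <-]]]; first exact: conj1g.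
rewrite conjMg; exists (v ^ g); first exact: UJ.
by exists (x ^ g) => //; exact: IH.
Qed.

Lemma generator_power_compact n : compact (generator_power n).
Proof. by elim: n => [|n IH]; [exact: compact_set1|exact: mulset_compact]. Qed.

Lemma generated_subgroup_group : subgroup_set L.
Proof.
split=> [|x y [m Xx] [n Yy]|x [n Xx]]; first by exists 0%N.
- by exists (m + n)%N; exact: generator_powerD.
- by exists n; exact: generator_powerV.
Qed.

Lemma generated_subgroupJ l g : L l -> L (l ^ g).
Proof. by move=> [n Ll]; exists n; exact: generator_powerJ. Qed.

Lemma sub_generated_subgroup : V `<=` L.
Proof. by move=> v Vv; exists 1%N; exists v => //; exists 1; rewrite ?mulg1. Qed.

Lemma nbhs_generated_subgroup : nbhs (1 : G) L.
Proof. by apply: filterS (U1 0); exact: sub_generated_subgroup. Qed.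

Lemma generated_subgroup_closed : closed L.
Proof.
exact: open_subgroup_closed generated_subgroup_group nbhs_generated_subgroup.
Qed.

Let L_1 : L 1. Proof. by case: generated_subgroup_group. Qed.
Let LM x y : L x -> L y -> L (x * y).
Proof. by case: generated_subgroup_group => _ + _; apply. Qed.
Let LV x : L x -> L x^-1.
Proof. by case: generated_subgroup_group => _ _; apply. Qed.

(** The neighbourhoods of [1] for the topology of uniform convergence on [V] of
    the conjugation action. *)
Definition almost_central k : set G :=
  [set g | L g /\ forall v, V v -> U k [~ g, v]].

Lemma almost_central_chain : nbhs_chain almost_central.
Proof.
split=> [k|k x [Lx xV]|k x y [Lx xV] [Ly yV]|k g].
- by split=> // v _; rewrite comm1g; exact: (nbhs_chain1 cU).
- split=> [|v Vv]; first exact: LV.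
  rewrite (_ : [~ x^-1, v] = ([~ x, v]^-1) ^ x^-1).
    by apply: UJ; apply: (nbhs_chainV cU); exact: xV.
  by rewrite !commgEl !conjgE !invgM !invgK -!mulgA mulgV mulg1.
- split=> [|v Vv]; first exact: LM.
  rewrite (_ : [~ x * y, v] = [~ x, v] ^ y * [~ y, v]).
    by apply: (nbhs_chainM cU); [apply: UJ; exact: xV|exact: yV].
  by rewrite !commgEl !conjgE !invgM -!mulgA !mulVKg.
- exists k => x [Lx xV]; split=> [|v Vv]; first exact: generated_subgroupJ.
  rewrite -[v](conjgKV g) -conjRg; apply: UJ; apply: xV.
  exact: UJ.
Qed.

Lemma nbhs_almost_central k : nbhs (1 : G) (almost_central k).
Proof.
apply: filterS (U1 k.+1) => g Ug.
have Lg : L g.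
  by apply: sub_generated_subgroup; apply: (nbhs_chain_mono cU _ Ug).
split=> // v _; rewrite commgEl; apply: (nbhs_chainM cU); last exact: UJ.
exact: (nbhs_chainV cU).
Qed.

Lemma almost_central_closed k : closed (almost_central k).
Proof.
rewrite (_ : almost_central k =
  L `&` \bigcap_(v in V) [set g | U k [~ g, v]]); last by [].
apply: closedI; first exact: generated_subgroup_closed.
apply: closed_bigI => v _; apply: (@closed_preimage _ (fun g => [~ g, v])).
  exact: continuous_commg.
exact: clU.
Qed.

(** [core] is a compact normal subgroup, and [centre_mod_core] is the kernel of
    the conjugation action modulo [core]. Working modulo [core] replaces the
    topology of [G] by one with a countable base at [1], as Baire's argument
    requires. *)
Definition core : set G := [set x | forall k, U k x].
Definition centre_mod_core : set G := [set g | forall k, almost_central k g].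
Notation K := core.
Notation Z := centre_mod_core.

Lemma core_subgroup : subgroup_set K.
Proof.
split=> [k|x y Kx Ky k|x Kx k].
- exact: (nbhs_chain1 cU).
- by apply: (nbhs_chainM cU); [exact: Kx|exact: Ky].
- by apply: (nbhs_chainV cU); exact: Kx.
Qed.

Lemma coreJ g x : K x -> K (x ^ g).
Proof. by move=> Kx k; apply: UJ; exact: Kx. Qed.

Lemma core_compact : compact K.
Proof.
apply: (@subclosed_compact _ _ V) => //; last by move=> x /(_ 0%N).
rewrite (_ : core = \bigcap_(k in setT) U k); first by apply: closed_bigI => k _.
by apply/funext => x; apply/propext; split=> [Kx k _|Kx k]; exact: Kx.
Qed.

Lemma centre_mod_core_subgroup : subgroup_set Z.
Proof.
have cA := almost_central_chain.
split=> [k|x y Zx Zy k|x Zx k].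
- exact: (nbhs_chain1 cA).
- by apply: (nbhs_chainM cA); [exact: Zx|exact: Zy].
- by apply: (nbhs_chainV cA); exact: Zx.
Qed.

Lemma centre_mod_core_closed : closed Z.
Proof.
rewrite (_ : Z = \bigcap_(k in setT) almost_central k).
  by apply: closed_bigI => k _; exact: almost_central_closed.
by apply/funext => x; apply/propext; split=> [Kx k _|Kx k]; exact: Kx.
Qed.

Lemma core_centre : K `<=` Z.
Proof.
move=> x Kx k; split=> [|v Vv]; first exact: sub_generated_subgroup (Kx 0%N).
rewrite commgEl; apply: (nbhs_chainM cU); last by apply: UJ; exact: Kx.
by apply: (nbhs_chainV cU); exact: Kx.
Qed.

Let ZL x : Z x -> L x. Proof. by move=> /(_ 0%N) []. Qed.

(** Elements which are central modulo [core] for the generators [V] of [L] are so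
    for all of [L]. *)
Lemma centre_mod_core_comm z l : Z z -> L l -> K [~ z, l].
Proof.
move=> Zz [n]; have [K1 KM KV] := core_subgroup.
elim: n l => [l ->|n IH _ [v Vv [x Xx <-]]]; first by rewrite commg1.
rewrite (_ : [~ z, v * x] = [~ z, x] * [~ z, v] ^ x).
  apply: KM; first exact: IH.
  by apply: coreJ => k; case: (Zz k) => _; apply.
by rewrite !commgEl !conjgE !invgM -!mulgA !mulVKg.
Qed.

(** The action of [L] on the compact set [V] is equicontinuous, because the [U k]
    are invariant. It is therefore determined up to [U k] by what it does, up to
    [U k.+2], to a finite net [vs] of [V], and there are finitely many maps from
    [vs] to itself. *)
Lemma almost_central_precompact k : exists2 F : seq G,
  forall f, f \in F -> L f &
  forall g, L g -> exists2 f, f \in F & almost_central k (f^-1 * g).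
Proof.
have [|vs vsV vsP] := @compact_finite_cover _ V
    (fun x => [set y | U k.+2 (x^-1 * y)]) cptU.
  move=> x _; apply/nbhs_mulg; apply: filterS (U1 k.+2) => u /=.
  by rewrite mulKg.
pose r := size vs; pose v (i : 'I_r) := nth 1 vs i.
have [code codeP] : {code : G -> {ffun 'I_r -> 'I_r} &
    forall g i, U k.+2 ((v (code g i))^-1 * v i ^ g)}.
  apply: (@choice _ _ (fun g (c : {ffun 'I_r -> 'I_r}) =>
    forall i, U k.+2 ((v (c i))^-1 * v i ^ g))) => g.
  have [c cP] : {c & forall i, U k.+2 ((v (c i))^-1 * v i ^ g)}.
    apply: (@choice _ _ (fun i c => U k.+2 ((v c)^-1 * v i ^ g))) => i.
    have [|x xs Ux] := vsP (v i ^ g); first by apply: UJ; apply: vsV; exact: mem_nth.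
    have xr : (index x vs < r)%N by rewrite index_mem.
    by exists (Ordinal xr); rewrite /v /= nth_index.
  by exists [ffun i => c i] => i; rewrite ffunE.
have [rep repP] : {rep & forall c, L (rep c) /\
    forall g, L g -> code g = c -> code (rep c) = c}.
  apply: (@choice _ _ (fun c f => L f /\ forall g, L g -> code g = c -> code f = c)) => c.
  have [[g [Lg gc]]|ng] := pselect (exists g, L g /\ code g = c); first by exists g.
  by exists 1; split=> // g Lg gc; case: ng; exists g.
exists [seq rep c | c <- enum {ffun 'I_r -> 'I_r}].
  by move=> _ /mapP [c _ ->]; case: (repP c).
move=> g Lg; set f := rep (code g); have [Lf fP] := repP (code g).
have fg : code f = code g by exact: fP Lg _.
exists f; first by apply: map_f; rewrite mem_enum.
split=> [|y Vy]; first by apply: LM => //; exact: LV.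
have [w Vw wE] : exists2 w, V w & w = y ^ f^-1 by exists (y ^ f^-1) => //; exact: UJ.
have [x xs Uxw] := vsP w Vw; have xr : (index x vs < r)%N by rewrite index_mem.
pose i := Ordinal xr.
have [e Ue we] : exists2 e, U k.+2 e & w = v i * e.
  by exists (x^-1 * w) => //; rewrite /v /= nth_index // mulVKg.
have -> : [~ f^-1 * g, y] = ((e ^ g)^-1 * ((v (code g i))^-1 * v i ^ g)^-1) *
    (((v (code g i))^-1 * v i ^ f) * e ^ f).
  have -> : [~ f^-1 * g, y] = (w ^ g)^-1 * w ^ f.
    by rewrite wE commgEl !conjgE !invgM !invgK -!mulgA mulVg mulg1 mulKg.
  by rewrite we !conjMg !invgM !invgK -!mulgA !mulVKg.
apply: (nbhs_chainM cU); apply: (nbhs_chainM cU).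
- by apply: (nbhs_chainV cU); exact: UJ.
- by apply: (nbhs_chainV cU); exact: codeP.
- by rewrite -fg; exact: codeP.
- exact: UJ.
Qed.

(** [L] is complete for the topology given by [almost_central], and it is the
    union of the subsets [V ^ n Z], closed because [V ^ n] is compact and [Z] is
    the intersection of the [almost_central k]. One of them has an interior point,
    and finitely many translates of it cover [L] by precompactness. *)
Lemma generated_subgroup_cocompact : exists T : set G,
  [/\ compact T, T 1, T `<=` L &
    forall y, L y -> exists t z, [/\ T t, Z z & y = t * z]].
Proof.
have cA := almost_central_chain; have subL := generated_subgroup_group.
have [Z1 ZM ZV] := centre_mod_core_subgroup.
have complete (x : nat -> G) : (forall n, L (x n)) ->
    chain_cauchy almost_central x ->
    exists2 l, L l & chain_converges almost_central x l.
  move=> Lx cx; have idC k : nbhs (1 : G) [set g | L g -> almost_central k g].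
    by apply: filterS (nbhs_almost_central k) => g Cg _; exact: Cg.
  apply: (c_compact_complete cA subL generated_subgroup_closed
    (phi := id) _ idC cG _ cx) => //.
  by move=> n; exists (x n).
have [||n y Ly nCy|n [x [k [Lx xC]]]] :=
  @baire _ _ cA L subL _ complete (fun n => mulset (generator_power n) Z) _ _.
- by move=> k g [].
- by move=> g [n gn]; exists n => //; exists g => //; exists 1; rewrite ?mulg1.
- apply: contrapT => nj.
  have [||j|v Xv vP] := @compact_nested _ (generator_power n)
    (fun j => [set v | almost_central j (v^-1 * y)]) (@generator_power_compact n).
  + move=> j; apply: (@closed_preimage _ (fun v => v^-1 * y)); last first.
      exact: almost_central_closed.
    apply: continuous_mulg; first exact: invg_continuous.
    by move=> z; exact: cvg_cst.
  + by move=> j v; exact: (nbhs_chainS cA).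
  + apply: contrapT => nX; apply: nj; exists j.+1 => u Cu [v Xv [z Zz vz]].
    apply: nX; exists v; split=> //=.
    rewrite -(mulgK u y) -vz -mulgA mulKg.
    by apply: (nbhs_chainM cA); [exact: Zz|exact: (nbhs_chainV cA)].
  + by apply: nCy; exists v => //; exists (v^-1 * y) => //; rewrite mulVKg.
have [F FL FP] := almost_central_precompact k.
(* Adding [1] to [T] makes [W] contain [V `&` Z] in the compactness proof below. *)
exists ([set 1] `|` mulset [set f * x^-1 | f in [set` F]] (generator_power n)); split.
- apply: compactU; first exact: compact_set1.
  apply: mulset_compact; last exact: generator_power_compact.
  by apply: finite_compact; apply: finite_image; exact: finite_seq.
- by left.
- move=> _ [->//|[_ [f fF <-] [v Xv <-]]]; apply: LM; last by exists n.
  by apply: LM; [exact: FL|exact: LV].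
- move=> y Ly; have [f fF /xC [v Xv [z Zz vz]]] := FP y Ly.
  exists (f * x^-1 * v), z; split=> //; last by rewrite -mulgA vz -mulgA mulKg mulVKg.
  by right; exists (f * x^-1); [exists f|exists v].
Qed.

(** The closure of the positive powers suffices, since only its stability under
    right multiplication by [f] is needed. *)
Definition monothetic (f : G) : set G := closure [set f ^+ n | n in [set: nat]].

Lemma monothetic1 f : monothetic f 1.
Proof. by apply: subset_closure; exists 0%N. Qed.

Lemma monotheticM f x : monothetic f x -> monothetic f (x * f).
Proof.
apply: (closure_image (f := fun x => x * f)); first exact: mulgr_continuous.
by move=> _ [n _ <-]; exists n.+1; rewrite ?expgSr.
Qed.

Lemma monothetic_sub f : Z f -> monothetic f `<=` Z.
Proof.
move=> Zf x; have [Z1 ZM _] := centre_mod_core_subgroup.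
move=> /(@closureS _ _ Z) H; apply: centre_mod_core_closed; apply: H.
by move=> _ [n _ <-]; elim: n => // n IH; rewrite expgS; exact: ZM.
Qed.

Fixpoint monothetic_product (fs : seq G) : set G :=
  if fs is f :: fs' then mulset (monothetic f) (monothetic_product fs') else K.

Lemma monothetic_product_compact fs : compact (monothetic_product fs).
Proof.
elim: fs => [|f fs IH] /=; first exact: core_compact.
apply: mulset_compact => //.
by apply: (monothetic_compact cG _ hG (U1 0)).
Qed.

Lemma monothetic_product1 fs : monothetic_product fs 1.
Proof.
elim: fs => [|f fs IH] /=; first by case: core_subgroup.
by exists 1; [exact: monothetic1|exists 1; rewrite ?mulg1].
Qed.

Lemma monothetic_product_sub fs : (forall f, f \in fs -> Z f) ->
  monothetic_product fs `<=` Z.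
Proof.
have [_ ZM _] := centre_mod_core_subgroup.
elim: fs => [|f fs IH] /= Zfs; first exact: core_centre.
move=> _ [x Mx [y My <-]]; apply: ZM.
  by apply: monothetic_sub Mx; apply: Zfs; rewrite mem_head.
by apply: IH My => g gs; apply: Zfs; rewrite inE gs orbT.
Qed.

Lemma monothetic_product_core fs c x : monothetic_product fs c -> K x ->
  monothetic_product fs (c * x).
Proof.
move=> + Kx; have [_ KM _] := core_subgroup.
elim: fs c => [c Kc|f fs IH _ [a Ma [c Mc <-]]] /=; first exact: KM.
by rewrite -mulgA; exists a => //; exists (c * x) => //; exact: IH.
Qed.

(** The new factor [f] is moved to the left, up to its own monothetic factor,
    at the cost of a commutator in [core]. *)
Lemma monothetic_productM fs c f : (forall g, g \in fs -> Z g) -> f \in fs ->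
  monothetic_product fs c -> monothetic_product fs (c * f).
Proof.
elim: fs c => // g fs IH _ Zfs + [a Ma [c Mc <-]].
have Zfs' h : h \in fs -> Z h by move=> hs; apply: Zfs; rewrite inE hs orbT.
rewrite inE => /orP[/eqP ->|ffs].
  have Zc : Z c by exact: monothetic_product_sub Mc.
  exists (a * g); first exact: monotheticM.
  exists (c * [~ c, g]); last by rewrite -!mulgA [g * (c * _)]mulgA -commgC.
  apply: monothetic_product_core => //; apply: centre_mod_core_comm => //.
  by apply: ZL; apply: Zfs; rewrite mem_head.
by exists a => //; exists (c * f); [exact: IH|rewrite mulgA].
Qed.

(** With [L = T Z], the elements of [Z] needed to write the products of elements of
    [V] are products of elements [t'^-1 v t] of the compact set [W]. A product of
    two elements of [W] is an element of [W] times one of the finitely many [fs],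
    and [C] absorbs the latter modulo [core]. Hence [L] is contained in [T C W]. *)
Lemma generated_subgroup_compact : compact L.
Proof.
have [T [cT T1 TL LTZ]] := generated_subgroup_cocompact.
have [Z1 ZM ZV] := centre_mod_core_subgroup.
have [_ KM KV] := core_subgroup.
pose W := mulset (mulset [set t^-1 | t in T] V) T `&` Z.
have WP t v t' : T t -> V v -> T t' -> Z (t^-1 * v * t') -> W (t^-1 * v * t').
  move=> Tt Vv Tt' Zw; split=> //; exists (t^-1 * v); last by exists t'.
  by exists t^-1; [exists t|exists v].
have VW v : V v -> Z v -> W v.
  by move=> Vv Zv; have := WP 1 v 1 T1 Vv T1; rewrite invg1 mul1g mulg1; apply.
have cW : compact W.
  apply: compact_closedI; last exact: centre_mod_core_closed.
  apply: mulset_compact => //; apply: mulset_compact => //.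
  apply: continuous_compact => //.
  by apply: continuous_subspaceT; exact: invg_continuous.
have WW_Z : mulset W W `<=` Z by move=> _ [x [_ Zx] [y [_ Zy] <-]]; exact: ZM.
have [|fs fsW fsP] := @compact_finite_cover _ (mulset W W)
    (fun x => [set y | V (x^-1 * y)]) (mulset_compact cW cW).
  move=> x _; apply/nbhs_mulg; apply: filterS (U1 0) => u /=.
  by rewrite mulKg.
have Zfs f : f \in fs -> Z f by move=> /fsW /WW_Z.
have WW x y : W x -> W y -> exists f w, [/\ f \in fs, W w & x * y = f * w].
  move=> Wx Wy; have WWxy : mulset W W (x * y) by exact: mulsetM.
  have [f ffs Vf] := fsP _ WWxy.
  exists f, (f^-1 * (x * y)); rewrite mulVKg; split=> //; apply: VW => //.
  by apply: ZM; [apply: ZV; exact: Zfs|exact: WW_Z].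
set C := monothetic_product fs.
have CZ : C `<=` Z by exact: monothetic_product_sub.
apply: (@subclosed_compact _ _ (mulset (mulset T C) W)).
- exact: generated_subgroup_closed.
- apply: mulset_compact => //; apply: mulset_compact => //.
  exact: monothetic_product_compact.
move=> x [n]; elim: n x => [x ->|n IH _ [v Vv [x /IH [_ [t Tt [c Cc <-]] [w Ww <-]] <-]]].
  exists (1 * 1); last by exists 1; rewrite ?mulg1 //; exact: VW.
  by exists 1 => //; exists 1 => //; exact: monothetic_product1.
have [t' [z [Tt' Zz vt]]] : exists t' z, [/\ T t', Z z & v * t = t' * z].
  by apply: LTZ; apply: LM; [exact: sub_generated_subgroup|exact: TL].
have Wz : W z.
  have zE : z = t'^-1 * v * t by rewrite -mulgA vt mulKg.
  by rewrite zE; apply: WP => //; rewrite -zE.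
have [f [w' [ffs Ww' zw]]] := WW z w Wz Ww.
(* [v t c w = t' z c w = t' c z [~ z, c] w]; moving the commutator to the right of
   [f = z w w'^-1] gives [t' (c f k) w'], where [k] is in [core]. *)
pose k := [~ z, c] ^ (w * w'^-1).
have Kk : K k by apply/coreJ/centre_mod_core_comm => //; apply: ZL; exact: CZ.
exists (t' * (c * f * k)).
  exists t' => //; exists (c * f * k) => //.
  by apply: monothetic_product_core => //; exact: monothetic_productM.
exists w' => //.
have fE : f = z * w * w'^-1 by rewrite zw mulgK.
rewrite fE /k !conjgE invgM invgK !mulgA vt -!mulgA.
by rewrite mulKg !mulVKg mulVg mulg1.
Qed.

End CompactlyGenerated.

Lemma compact_of_small_invariant_nbhs (G : topologicalGroupType) :
  (forall P : groupType, countable [set: P] ->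
     hereditarily_non_topologizable P -> finite_set [set: P]) ->
  hausdorff_space G -> locally_compact [set: G] -> c_compact G ->
  small_invariant_nbhs G -> compact [set: G].
Proof.
move=> finP hG lcG cG sinG.
have [V0 V01 [cV0 _]] : exists2 V0, nbhs (1 : G) V0 & compact V0 /\ closed V0.
  have [V0 V01 cV0] := lcG 1 I; exists V0 => //.
  by move: V01; rewrite /within /=; apply: filterS => x; apply.
have [U [cU U1 clU UJ UV0]] := invariant_nbhs_chain sinG V01.
have cptU : compact (U 0%N) by apply: subclosed_compact (clU 0%N) cV0 UV0.
have cL := generated_subgroup_compact hG cG cU U1 clU UJ cptU finP.
have [s sP] := open_normal_index_finite cG finP (generated_subgroup_group cU)
  (nbhs_generated_subgroup U1) (fun l g => @generated_subgroupJ _ _ UJ l g).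
rewrite (_ : [set: G] = mulset [set` s] (generated_subgroup U)).
  by apply: mulset_compact cL; apply: finite_compact; exact: finite_seq.
apply/funext => g; apply/propext; split=> // _.
by have [y ys Ly] := sP g; exists y => //; exists (y^-1 * g) => //; rewrite mulVKg.
Qed.

Theorem theorem7 :
  (forall G : topologicalGroupType,
     hausdorff_space G ->
     locally_compact [set: G] ->
     c_compact G ->
     small_invariant_nbhs G ->
     compact [set: G])
  <->
  (forall G : groupType,
     countable [set: G] ->
     hereditarily_non_topologizable G ->
     finite_set [set: G]).
Proof.
split=> [cpt G _|fin G]; first exact: finite_of_compact_discrete.
exact: compact_of_small_invariant_nbhs.
Qed.
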